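(* Let $X$ be a nonempty compact metric space and let $\phi$ be the semiflow of an impulsive dynamical system $(X,\varphi,D,I)$ for which $\tau_D:\Omega_\phi\to[0,+\infty]$ is continuous and $I(\Omega_\phi\cap D)\subset\Omega_\phi\setminus D$. Then there are a compact metric space $Y$, a continuous semiflow $\psi$ in $Y$ and a continuous invertible bimeasurable map $h:\Omega_\phi\setminus D\to Y$ such that $$\psi_t\circ h|_{\Omega_\phi\setminus D}=h\circ\phi_t|_{\Omega_\phi\setminus D}\quad\text{for all } t\ge0.$$ Moreover, if $\iota:\Omega_\phi\setminus D\to X$ denotes the inclusion map, then $(\iota\circ h^{-1})_*:\mathcal M_\psi(Y)\to\mathcal M_\phi(X)$ is a bijection.
   Context: A semiflow on a metric space $X$ is a map $\phi:\mathbb{R}^+_0\times X\to X$, $\phi_t(x)=\phi(t,x)$, with $\phi_0(x)=x$ and $\phi_{t+s}(x)=\phi_t(\phi_s(x))$ for all $x\in X$, $s,t\ge 0$ (not necessarily continuous); a continuous semiflow is one that is continuous as a map on $\mathbb{R}^+_0\times X$. Non-wandering set: $x\in X$ is non-wandering for $\phi$ if for every neighborhood $U$ of $x$ and any $T>0$ there exists $t\ge T$ with $\phi_t^{-1}(U)\cap U\ne\emptyset$; $\Omega_\phi$ denotes the set of all non-wandering points. Impulsive dynamical system: let $\varphi:\mathbb{R}^+_0\times X\to X$ be a continuous semiflow, $D\subset X$ a compact set and $I:D\to X$ a continuous function. Put $\tau_1(x)=\inf\{t>0:\varphi_t(x)\in D\}$ if $\varphi_t(x)\in D$ for some $t>0$,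 and $\tau_1(x)=+\infty$ otherwise. Assume $\tau_1(x)>0$ for all $x\in X$. The impulsive trajectory $\gamma_x$ and impulsive times $\tau_n(x)$ of $x$ are defined by: $\gamma_x(t)=\varphi_t(x)$ for $0\le t<\tau_1(x)$; if $\tau_1(x)<\infty$, then $\gamma_x(\tau_1(x))=I(\varphi_{\tau_1(x)}(x))$; inductively, as long as $\tau_n(x)<\infty$, $\tau_{n+1}(x)=\tau_n(x)+\tau_1(\gamma_x(\tau_n(x)))$, $\gamma_x(t)=\varphi_{t-\tau_n(x)}(\gamma_x(\tau_n(x)))$ for $\tau_n(x)<t<\tau_{n+1}(x)$, and, if $\tau_{n+1}(x)<\infty$, $\gamma_x(\tau_{n+1}(x))=I(\varphi_{\tau_{n+1}(x)-\tau_n(x)}(\gamma_x(\tau_n(x))))$. Put $T(x)=\sup_{n\ge1}\tau_n(x)$ (the supremum over all impulsive times that are defined). The tuple $(X,\varphi,D,I)$ is an impulsive dynamical system if $\tau_1(x)>0$ and $T(x)=+\infty$ for all $x\in X$. Its (impulsive) semiflow is $\phi:\mathbb{R}^+_0\times X\to X$, $\phi(t,x)=\gamma_x(t)$; it is a semiflow, not necessarily continuous. The function $\tau_D:\Omega_\phi\to[0,+\infty]$ is defined by $\tau_D(x)=\tau_1(x)$ if $x\in\Omega_\phi\setminus D$ and $\tau_D(x)=0$ if $x\in\Omega_\phi\cap D$; here $[0,+\infty]$ carries the one-point compactification topology and $\Omega_\phi$ the subspace topology. Measures: measurable means Borel measurable; an invertible map is bimeasurable if it and its inverse are measurable. $\mathcal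 M(Z)$ is the set of Borel probability measures on a topological space $Z$. For a semiflow $\phi$ on $Z$, a measure $\mu\in\mathcal M(Z)$ is $\phi$-invariant if $\phi$ is measurable and $\mu(\phi_t^{-1}(A))=\mu(A)$ for every Borel set $A\subset Z$ and every $t\ge0$; $\mathcal M_\phi(Z)$ is the set of $\phi$-invariant measures in $\mathcal M(Z)$. For a measurable map $f$, $f_*\mu(B)=\mu(f^{-1}(B))$ is the push-forward; the assertion on $(\iota\circ h^{-1})_*$ includes that it maps $\mathcal M_\psi(Y)$ into $\mathcal M_\phi(X)$. Under the stated hypothesis on $I$ one has $\phi_t(\Omega_\phi\setminus D)\subset\Omega_\phi\setminus D$ for all $t\ge 0$, so $h\circ\phi_t|_{\Omega_\phi\setminus D}$ is well defined. *)

(* Defs.v *)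
From HB Require Import structures.
From mathcomp Require Import all_boot all_order all_algebra.
From mathcomp Require Import all_classical all_reals all_analysis.

Set Implicit Arguments.
Unset Strict Implicit.
Unset Printing Implicit Defensive.

Import Order.TTheory GRing.Theory Num.Theory.
Import numFieldNormedType.Exports.

Local Open Scope classical_set_scope.
Local Open Scope ring_scope.
Local Open Scope ereal_scope.

(* Nonempty metric spaces: the library's measurable types are pointed. *)
#[short(type="pmetricType")]
HB.structure Definition PointedMetric (K : numDomainType) :=
  { M of Metric K M & Pointed M }.

(* A semiflow is a map R -> Z -> Z of which only the values at times t >= 0
   are meaningful. *)
Section semiflow.
Context {R : realType}.

Definition semiflow (Z : Type) (phi : R -> Z -> Z) :=
  (forall x, phi 0%R x = x) /\
  (forall s t x, (0 <= s)%R -> (0 <= t)%R ->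
    phi (t + s)%R x = phi t (phi s x)).

Definition continuous_semiflow (Z : topologicalType) (phi : R -> Z -> Z) :=
  semiflow phi /\
  {within [set p : R * Z | (0 <= p.1)%R], continuous (fun p => phi p.1 p.2)}.

Definition nonwandering (Z : topologicalType) (phi : R -> Z -> Z) : set Z :=
  [set x | forall U, nbhs x U -> forall T : R, (0 < T)%R ->
    exists2 t : R, (T <= t)%R & (phi t @^-1` U) `&` U !=set0].

End semiflow.

Section impulsive.
Context {R : realType} {X : topologicalType}.
Variables (varphi : R -> X -> X) (D : set X) (I : X -> X).

(* ereal_inf set0 = +oo *)
Definition tau1 (x : X) : \bar R :=
  ereal_inf [set t%:E | t in [set t : R | (0 < t)%R /\ D (varphi t x)]].

(* [impulse x n] is the pair (tau_n(x), gamma_x(tau_n(x))), with the convention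
   tau_0(x) = 0. An undefined tau_n(x) is encoded by +oo, in which case the
   second component is irrelevant. *)
Definition next_impulse (p : \bar R * X) : \bar R * X :=
  (p.1 + tau1 p.2, I (varphi (fine (tau1 p.2)) p.2)).

Definition impulse (x : X) (n : nat) : \bar R * X :=
  iter n next_impulse (0, x).

Definition impulse_time (x : X) (n : nat) : \bar R := (impulse x n).1.
Definition impulse_point (x : X) (n : nat) : X := (impulse x n).2.

(* The intervals [tau_n(x), tau_(n+1)(x)[ are disjoint, so there is at most one
   index to choose from; at t = tau_n(x) the value is
   varphi_0(impulse_point x n) = impulse_point x n. *)
Definition impulsive_trajectory (x : X) (t : R) : X :=
  let n := xget 0%N
    [set n | impulse_time x n <= t%:E < impulse_time x n.+1] in
  varphi (t - fine (impulse_time x n))%R (impulse_point x n).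

Definition impulsive_semiflow (t : R) (x : X) : X := impulsive_trajectory x t.

(* Only the restriction of I to D is meaningful. *)
Definition impulsive_dynamical_system :=
  [/\ continuous_semiflow varphi,
      compact D,
      {within D, continuous I},
      (forall x, 0 < tau1 x) &
      (forall x,
        ereal_sup [set impulse_time x n | n in [set n | (1 <= n)%N]] = +oo)].

Definition tauD (x : X) : \bar R := if x \in D then 0 else tau1 x.

End impulsive.

Definition borel {Z : topologicalType} : set (set Z) := <<s @open Z >>.

(* [measurable_fun] for the Borel sigma-algebras of topological spaces that need
   not be pointed, on a domain E that is itself Borel. *)
Definition borel_fun {Z W : topologicalType} (E : set Z) (f : Z -> W) :=
  forall B, borel B -> borel (E `&` f @^-1` B).

Notation borelType Z := (g_sigma_algebraType (@open Z)).

(* The library's measures are total functions on [set Z]; as Borel measures they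
   are equal when they agree on Borel sets. *)
Definition borel_eq {R : realType} {Z : topologicalType}
    (m1 m2 : set Z -> \bar R) :=
  forall A, borel A -> m1 A = m2 A.

Definition invariant_measures {R : realType} {Z : ptopologicalType}
    (phi : R -> Z -> Z) : set (probability (borelType Z) R) :=
  [set mu |
    borel_fun [set p : R * Z | (0 <= p.1)%R] (fun p => phi p.1 p.2) /\
    forall (t : R) (A : set Z), (0 <= t)%R -> borel A ->
      mu (phi t @^-1` A) = mu A].

(* mu |-> f_* mu is a bijection from M onto N, measures being identified when
   they agree on Borel sets. *)
Definition pushforward_bijection {R : realType} {Z W : ptopologicalType}
    (f : Z -> W) (M : set (probability (borelType Z) R))
    (N : set (probability (borelType W) R)) :=
  let push (mu : probability (borelType Z) R) : set W -> \bar R :=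
    pushforward mu (f : borelType Z -> borelType W) in
  [/\ (forall mu, M mu -> exists2 nu, N nu & borel_eq (push mu) nu),
      (forall mu1 mu2, M mu1 -> M mu2 ->
        borel_eq (push mu1) (push mu2) -> borel_eq mu1 mu2) &
      (forall nu, N nu -> exists2 mu, M mu & borel_eq (push mu) nu)].

(* Main.v *)
Require Import Defs.
From HB Require Import structures.
From mathcomp Require Import all_boot all_order all_algebra.
From mathcomp Require Import all_classical all_reals all_analysis.
From mathcomp Require Import lra.
Set Implicit Arguments.
Unset Strict Implicit.
Unset Printing Implicit Defensive.
Import Order.TTheory GRing.Theory Num.Theory.
Import numFieldNormedType.Exports.
Local Open Scope classical_set_scope.
Local Open Scope ring_scope.

(** The semiflow [phi] is discontinuous only where an orbit hits [D] and jumps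
    from a point [e] to [I e]. If [e] and [I e] are identified, the jump becomes
    invisible; [Y] is the result of this identification in the compact set
    [Omega] of non-wandering points.

    Off [D] the first passage time is lower semicontinuous ([tau1_lsc]), so
    [phi] follows the continuous semiflow [varphi] on a neighbourhood and
    non-wandering points stay non-wandering until they hit [D]. The hitting
    point is in [Omega] because [Omega] is closed, and [I] sends it back to
    [Omega \ D]. Hence [Omega \ D] is invariant
    ([nonwandering_invariant]).

    As [I] maps [Omega /\ D] into [Omega \ D], each class of the identification
    contains exactly one point of [Omega \ D]. So [Y] is [Omega \ D] with
    another metric ([gluing]), the quotient map [q : Omega -> Y] restricts to the
    bijection [h], and the inverse [s] of [h] gives the semiflow
    [psi t y = q (phi t (s y))]. For the continuity of [psi], it suffices that
    [q (phi t x)] depends continuously on [t] and [x], with [x] replaced by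
    [I x] when it is in [D] ([near_quotient]). Here continuity of [tauD] is
    decisive: nearby points jump at nearby times, and during the delay between
    the two jumps one orbit is close to [e], the other to [I e], which have the
    same image under [q] ([glued_flow_near]).

    The map [q] sends compact sets to compact sets and the traces of open sets
    on [Omega \ D] are sigma-compact, hence [s] is Borel ([borel_section]).
    The invariant measures of [phi] and [psi] then correspond to each other
    ([conjugacy_invariant_measures]) as soon as those of [phi] give no mass to
    the complement of [Omega \ D]. Poincare recurrence does not need
    continuity and shows that the wandering points are null
    ([nonwandering_full]); [Omega /\ D] is null because orbits leave [D] at
    once and cannot enter [Omega /\ D] from [Omega \ D] ([transient_null]).
    Finally, an invariant measure requires a measurable semiflow, and [phi] is
    Borel on the whole of [X]: it is obtained from [varphi] by iterating the
    Borel map that follows an orbit through its first impulse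
    ([borel_impulsive_semiflow]). *)

(** * Borel sets and Borel functions *)

(** The default value [j0] makes room for the empty set. *)
Lemma countable_enum (J : choiceType) (j0 : J) (D : set J) : countable D ->
  exists f : nat -> J, forall j, D j -> exists n, f n = j.
Proof.
move=> /countable_injP[e eD].
exists (fun n => xget j0 [set j | D j /\ e j = n]) => j Dj; exists (e j).
case: xgetP => [k -> [Dk ekj]|/(_ j)/not_andP[]//].
by apply: eD; rewrite ?inE.
Qed.

Section borel_sets.
Context {Z : topologicalType}.
Implicit Types A B : set Z.

Lemma borel_open A : open A -> borel A.
Proof. by move=> oA; rewrite /borel; apply: sub_sigma_algebra. Qed.

Lemma borelT : borel [set: Z].
Proof. exact: borel_open openT. Qed.

Lemma borelC A : borel A -> borel (~` A).
Proof. by move=> bA; rewrite -setTD; exact: sigma_algebraCD. Qed.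

Lemma borel_closed A : closed A -> borel A.
Proof. by move=> cA; rewrite -(setCK A); exact: borelC (borel_open (closed_openC cA)). Qed.

Lemma borel_bigcup (F : nat -> set Z) :
  (forall n, borel (F n)) -> borel (\bigcup_n F n).
Proof. exact: sigma_algebra_bigcup. Qed.

Lemma borel0 : borel (@set0 Z).
Proof. exact: sigma_algebra0. Qed.

Lemma borelU A B : borel A -> borel B -> borel (A `|` B).
Proof.
move=> bA bB; rewrite -bigcup2E; apply borel_bigcup => -[|[|n]] //=.
exact: borel0.
Qed.

Lemma borelI A B : borel A -> borel B -> borel (A `&` B).
Proof.
move=> bA bB; rewrite -(setCK (A `&` B)) setCI.
by apply borelC; apply borelU; apply borelC.
Qed.

Lemma borelD A B : borel A -> borel B -> borel (A `\` B).
Proof. by move=> bA bB; rewrite setDE; apply borelI => //; apply borelC. Qed.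

Lemma borel_bigcup_countable (J : choiceType) (D : set J) (F : J -> set Z) :
  countable D -> (forall j, D j -> borel (F j)) -> borel (\bigcup_(j in D) F j).
Proof.
move=> cD bF; have [->|/set0P[j0 Dj0]] := eqVneq D set0.
  by rewrite bigcup_set0; exact: borel0.
have [f fD] := countable_enum j0 cD.
have fDs n : exists j, D j /\ (D (f n) -> j = f n).
  by have [Dfn|nD] := pselect (D (f n)); [exists (f n)|exists j0].
pose g n := sval (cid (fDs n)).
have -> : \bigcup_(j in D) F j = \bigcup_n F (g n).
  apply/seteqP; split => [z [j Dj Fz]|z [n _ Fz]]; last first.
    by exists (g n) => //; rewrite /g; case: cid => k [].
  have [n fn] := fD _ Dj; exists n => //.
  rewrite /g; case: cid => k [_ /=]; rewrite fn => /(_ Dj) ->; exact: Fz.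
by apply borel_bigcup => n; apply: bF; rewrite /g; case: cid => k [].
Qed.

End borel_sets.

Section borel_functions.
Context {Z W V : topologicalType}.

(** Only preimages of open sets have to be examined: the sets with a Borel
    preimage form a sigma-algebra. *)
Lemma borel_fun_open (E : set Z) (f : Z -> W) :
  (forall U, open U -> borel (E `&` f @^-1` U)) -> borel_fun E f.
Proof.
move=> fo.
have bE : borel E by have := fo setT openT; rewrite preimage_setT setIT.
pose G : set (set W) := [set B | borel (E `&` f @^-1` B)].
suff : borel `<=` G by move=> + B bB; exact.
apply: smallest_sub; last by move=> U; exact: fo.
split; rewrite /G/=.
- by rewrite preimage_set0 setI0; exact: borel0.
- move=> B bB; rewrite setTD preimage_setC.
  rewrite (_ : E `&` _ = E `\` (E `&` f @^-1` B)); first exact: borelD.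
  by rewrite setDIr setDv set0U setDE.
- move=> F bF; rewrite preimage_bigcup setI_bigcupr; by apply borel_bigcup.
Qed.

Lemma borel_fun_dom (E : set Z) (f : Z -> W) : borel_fun E f -> borel E.
Proof. by move=> /(_ _ borelT); rewrite preimage_setT setIT. Qed.

Lemma borel_fun_continuous (E : set Z) (f : Z -> W) :
  borel E -> {within E, continuous f} -> borel_fun E f.
Proof.
move=> bE /continuousP cf; apply: borel_fun_open => U /cf/open_subspaceP.
by case=> V0 oV; rewrite (setIC E) => <-; apply borelI => //; apply borel_open.
Qed.

Lemma borel_fun_comp (E : set Z) (F : set W) (f : Z -> W) (g : W -> V) :
  borel_fun E f -> borel_fun F g -> f @` E `<=` F -> borel_fun E (g \o f).
Proof.
move=> bf bg fEF B bB.
rewrite (_ : E `&` _ = E `&` f @^-1` (F `&` g @^-1` B)).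
  exact: bf (bg _ bB).
apply/seteqP; split => x /= [Ex]; last by move=> [].
by move=> Bx; split=> //; split=> //; apply: fEF; exists x.
Qed.

Lemma borel_fun_sub (E E' : set Z) (f : Z -> W) :
  borel_fun E f -> E' `<=` E -> borel E' -> borel_fun E' f.
Proof.
move=> bf EE bE' B bB.
by rewrite -(setIidl EE) -setIA; apply borelI => //; exact: bf.
Qed.

End borel_functions.

(** An open set of a product of second countable spaces is a countable union
    of rectangles, so measurability can be tested on each coordinate. *)
Lemma borel_fun_pair (Z W V : topologicalType) (E : set Z) (f : Z -> W) (g : Z -> V) :
  @second_countable W -> @second_countable V ->
  borel_fun E f -> borel_fun E g -> borel_fun E (fun z => (f z, g z)).
Proof.
move=> [B1 cB1 [oB1 bB1]] [B2 cB2 [oB2 bB2]] bf bg.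
apply borel_fun_open => U oU.
pose D := [set p : set W * set V | [/\ B1 p.1, B2 p.2 & p.1 `*` p.2 `<=` U]].
rewrite (_ : E `&` _ =
  \bigcup_(p in D) ((E `&` f @^-1` p.1) `&` (E `&` g @^-1` p.2))); last first.
  apply/seteqP; split => [z [Ez /= Uz]|z [[A B] [/= B1A B2B ABU]] [[Ez fz] [_ gz]]]; last first.
    by split=> //; apply: ABU.
  have : nbhs (f z, g z) U by exact: open_nbhs_nbhs.
  move=> [[P Q] /= [nP nQ] PQU].
  have [A [B1A Afz] AP] := bB1 _ _ nP; have [B [B2B Bgz] BQ] := bB2 _ _ nQ.
  exists (A, B) => //; split=> //= -[a b] [/= Aa Bb].
  by apply: PQU; split => /=; [exact: AP|exact: BQ].
apply borel_bigcup_countable.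
  by apply: (@sub_countable _ _ _ (B1 `*` B2)); [apply: subset_card_le => p []|exact: countableX].
move=> [A B] [/= B1A B2B _].
by apply borelI; [apply bf; apply borel_open; exact: oB1|apply bg; apply borel_open; exact: oB2].
Qed.

Lemma real_second_countable (R : realType) : @second_countable R.
Proof.
exists ((fun p : rat * rat => `]ratr p.1, (ratr p.2 : R)[%classic) @` setT).
  exact: sub_countable (card_image_le _ _) (countableP _).
split=> [_ [p _ <-]|x A [e /= e0 xeA]]; first exact: interval_open.
have /rat_in_itvoo[a] : x - e < x by rewrite ltrBlDr ltrDl.
have /rat_in_itvoo[b] : x < x + e by rewrite ltrDl.
rewrite !in_itv/= => /andP[xb be] /andP[ea ax].
exists `]ratr a, ratr b[%classic; first by split; [exists (a, b)|rewrite /= in_itv/= ax].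
move=> y /=; rewrite in_itv/= => /andP[ay yb]; apply: xeA.
rewrite /ball/= ltr_norml; apply/andP; split.
  by rewrite ltrBrDl ltrBlDr (lt_trans yb).
by rewrite ltrBlDl -ltrBlDr (lt_trans ea).
Qed.

(** The rays generate the Borel sets of the real line: an open set is a
    countable union of half-open intervals with rational endpoints. *)
Lemma borel_fun_lt (R : realType) (Z : topologicalType) (E : set Z) (f : Z -> R) :
  (forall r, borel (E `&` [set x | f x < r])) -> borel_fun E f.
Proof.
move=> bf; apply: borel_fun_open => U oU.
pose D := [set p : rat * rat | [set y : R | ratr p.1 <= y < ratr p.2] `<=` U].
rewrite (_ : _ `&` _ = \bigcup_(p in D)
  ((E `&` [set x | f x < ratr p.2]) `\` (E `&` [set x | f x < ratr p.1]))).
  apply borel_bigcup_countable => [|p _]; first exact: countableP.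
  by apply borelD; exact: bf.
apply/seteqP; split=> [x [Ex /= Ux]|x [[a b] DU [[Ex /= fb] nfa]]]; last first.
  split=> //; apply: DU; rewrite /= fb andbT leNgt; apply/negP => fa.
  by apply: nfa.
have [e /= e0 xeU] : nbhs (f x) U by exact: open_nbhs_nbhs.
have /rat_in_itvoo[a] : f x - e < f x by rewrite ltrBlDr ltrDl.
have /rat_in_itvoo[b] : f x < f x + e by rewrite ltrDl.
rewrite !in_itv/= => /andP[xb be] /andP[ea ax].
exists (a, b) => [y /= /andP[ay yb]|].
  by apply: xeU; rewrite /ball_/= ltr_norml; apply/andP; split; lra.
by split=> //= -[_]; rewrite ltNge (ltW ax).
Qed.

Lemma closed_nonneg_time (R : realType) (Z : topologicalType) :
  closed [set p : R * Z | 0 <= p.1].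
Proof.
apply: (@preimage_closed _ _ fst [set t : R | 0 <= t]); last exact: closed_ge.
by move=> p _; exact: cvg_fst.
Qed.

(** * First passage times and the semiflow of an impulsive system *)

Lemma nonwandering_closed (R : realType) (Z : topologicalType) (phi : R -> Z -> Z) :
  closed (nonwandering phi).
Proof.
move=> x clx U nU T T0.
have [y [Oy Uy]] := clx _ (nbhs_interior nU).
exact: Oy Uy _ T0.
Qed.

Section impulsive_flow.
Context {R : realType} {X : topologicalType}.
Context (varphi : R -> X -> X) (D : set X) (I : X -> X).
Context (flow : continuous_semiflow varphi) (clD : closed D).
Context (tau_gt0 : forall x, (0 < tau1 varphi D x)%E).
Context (tau_sup : forall x,
  ereal_sup [set impulse_time varphi D I x n | n in [set n | (1 <= n)%N]] = +oo%E).

Local Notation tau := (tau1 varphi D).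
Local Notation phi := (impulsive_semiflow varphi D I).
Local Notation itime := (impulse_time varphi D I).

Lemma varphi0 x : varphi 0 x = x.
Proof. by have [[]] := flow. Qed.

Lemma varphiD s t x : 0 <= s -> 0 <= t -> varphi (t + s) x = varphi t (varphi s x).
Proof. by have [[_ +] _] := flow; apply. Qed.

Lemma varphi_near t x U : 0 <= t -> nbhs (varphi t x) U ->
  \forall p \near (t, x), 0 <= p.1 -> U (varphi p.1 p.2).
Proof.
move=> t0 nU; have [_ /subspace_continuousP/(_ (t, x) t0)] := flow.
by move=> /(_ U nU).
Qed.

Lemma varphi_near_time t x U : 0 <= t -> nbhs (varphi t x) U ->
  \forall s \near t, 0 <= s -> U (varphi s x).
Proof.
move=> t0 nU; have [[A B] /= [nA nB] AB] := varphi_near t0 nU.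
apply: filterS nA => s As s0; apply: (AB (s, x)) => //; split=> //=.
exact: nbhs_singleton.
Qed.

(** The infimum defining [tau1] is attained because [D] is closed. *)
Lemma tau1_hit x r : tau x = r%:E -> 0 < r /\ D (varphi r x).
Proof.
move=> tx; have r0 : 0 < r by rewrite -lte_fin -tx.
split=> //; apply: contrapT => nD.
have nU : nbhs (varphi r x) (~` D).
  by apply: open_nbhs_nbhs; split=> //; exact: closed_openC.
have [e /= e0 re] := varphi_near_time (ltW r0) nU.
have [|y [s [s0 Ds] <-]] := @lb_ereal_inf_adherent _
    [set t%:E | t in [set t : R | 0 < t /\ D (varphi t x)]] e e0.
  by rewrite -/(tau x) tx.
rewrite -/(tau x) tx -EFinD lte_fin => sre.
have rs : r <= s by rewrite -lee_fin -tx; apply: ereal_inf_lbound; exists s.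
apply: (re s) (ltW s0) Ds.
by rewrite /ball_/= ltr_norml; apply/andP; split; lra.
Qed.

Lemma tau1_nohit x s : 0 < s -> (s%:E < tau x)%E -> ~ D (varphi s x).
Proof.
move=> s0 sx Ds; suff : (tau x <= s%:E)%E by rewrite leNgt sx.
by apply: ereal_inf_lbound; exists s.
Qed.

Lemma tau1_ge x (a : \bar R) :
  (forall s, 0 < s -> (s%:E < a)%E -> ~ D (varphi s x)) -> (a <= tau x)%E.
Proof.
move=> nh; apply: le_ereal_inf_tmp => _ [s [s0 Ds] <-].
by rewrite leNgt; apply/negP => sa; exact: nh Ds.
Qed.

Lemma tau1_gt x t : 0 <= t ->
  (forall s, 0 < s -> s <= t -> ~ D (varphi s x)) -> (t%:E < tau x)%E.
Proof.
move=> t0 nh; rewrite lt_neqAle; apply/andP; split.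
  by apply/eqP => /esym/tau1_hit[tp]; exact: nh.
by apply: tau1_ge => s s0; rewrite lte_fin => /ltW; exact: nh.
Qed.

Lemma tau1_cases x : tau x = +oo%E \/ exists2 r, tau x = r%:E & 0 < r.
Proof.
move: (tau_gt0 x); case E : (tau x) => [r| |]//; last by left.
by rewrite lte_fin => r0; right; exists r.
Qed.

Lemma tau1_shift x s : 0 <= s -> (s%:E < tau x)%E ->
  tau (varphi s x) = (tau x - s%:E)%E.
Proof.
move=> s0 sx; apply/eqP; rewrite eq_le; apply/andP; split.
  have [->|[r tx _]] := tau1_cases x; first by rewrite leey.
  have [r0 Dr] := tau1_hit tx; move: sx; rewrite tx lte_fin => sr.
  rewrite -EFinB leNgt; apply/negP => /(tau1_nohit _); apply; first by lra.
  by rewrite -varphiD ?subrK//; lra.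
apply: tau1_ge => t t0; rewrite lteBrDr// -EFinD => tsx.
by rewrite -varphiD//; [apply: tau1_nohit => //; lra|lra].
Qed.

Lemma impulse_time_ge0 x n : (0 <= itime x n)%E.
Proof.
elim: n => [|n]; first by [].
rewrite /impulse_time /impulse iterS /= => n0.
by apply: adde_ge0 => //; exact: ltW.
Qed.

Lemma impulse_time_le x m n : (m <= n)%N -> (itime x m <= itime x n)%E.
Proof.
elim: n => [|n IH]; first by rewrite leqn0 => /eqP ->.
rewrite leq_eqVlt => /predU1P[->//|]; rewrite ltnS => /IH mn.
apply: (le_trans mn); rewrite [leRHS]/impulse_time /impulse iterS /=.
by rewrite -/(impulse varphi D I x n) leeDl// ltW.
Qed.

(** Impulse times are ordered; hence the choice of an index in
    [impulsive_trajectory] leaves no freedom. *)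
Lemma impulse_index_unique x t m n :
  (itime x m <= t%:E < itime x m.+1)%E -> (itime x n <= t%:E < itime x n.+1)%E ->
  m = n.
Proof.
move=> /andP[m1 m2] /andP[n1 n2].
have [mn|nm|//] := ltngtP m n.
- have := impulse_time_le x mn.
  by rewrite leNgt (le_lt_trans n1 m2).
- have := impulse_time_le x nm.
  by rewrite leNgt (le_lt_trans m1 n2).
Qed.

Lemma impulse_time_unbounded x t : exists n, (t%:E < itime x n)%E.
Proof.
have : (t%:E < ereal_sup [set itime x n | n in [set n | (1 <= n)%N]])%E.
  by rewrite tau_sup ltry.
by move=> /ereal_sup_gt[_ [n _ <-] tn]; exists n.
Qed.

Lemma impulse_index_exists x t : 0 <= t ->
  exists n, (itime x n <= t%:E < itime x n.+1)%E.
Proof.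
move=> t0; have ex := impulse_time_unbounded x t.
case: (ex_minnP ex) => -[|n] tn nmin; first by move: tn; rewrite ltNge lee_fin t0.
exists n; rewrite tn andbT leNgt; apply/negP => /nmin; by rewrite ltnn.
Qed.

Lemma trajectory_index x t n : (itime x n <= t%:E < itime x n.+1)%E ->
  phi t x = varphi (t - fine (itime x n)) (impulse_point varphi D I x n).
Proof.
move=> xn; rewrite /impulsive_semiflow /impulsive_trajectory.
case: xgetP => [m -> xm|/(_ n)]; last by move=> /(_ xn).
by rewrite (impulse_index_unique xm xn).
Qed.

(** The impulses are generated by iteration at the end of the trajectory; proofs
    by induction peel off the first impulse instead. *)
Lemma impulse_shift x n :
  let x1 := I (varphi (fine (tau x)) x) in
  impulse varphi D I x n.+1 =
    ((tau x + itime x1 n)%E, impulse_point varphi D I x1 n).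
Proof.
move=> x1; elim: n => [|n IH].
  by rewrite /impulse_time /impulse_point /impulse /= /next_impulse /= adde0 add0e.
rewrite {1}/impulse iterS -/(impulse varphi D I x n.+1) IH /next_impulse /=.
by rewrite -addeA.
Qed.

Lemma impulsive_before_hit x t : 0 <= t -> (t%:E < tau x)%E -> phi t x = varphi t x.
Proof.
move=> t0 tx; rewrite (@trajectory_index x t 0%N) /= ?subr0//.
by rewrite lee_fin t0 /impulse_time /= add0e.
Qed.

Lemma impulsive_after_hit x t r : tau x = r%:E -> r <= t ->
  phi t x = phi (t - r) (I (varphi r x)).
Proof.
move=> tx rt; have tr0 : 0 <= t - r by lra.
have [n n12] := impulse_index_exists (I (varphi r x)) tr0.
rewrite (trajectory_index n12).
have sh k : impulse varphi D I x k.+1 = ((r%:E + itime (I (varphi r x)) k)%E,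
    impulse_point varphi D I (I (varphi r x)) k) by rewrite impulse_shift tx.
have timeE k : itime x k.+1 = (r%:E + itime (I (varphi r x)) k)%E.
  by rewrite {1}/impulse_time sh.
rewrite (@trajectory_index x t n.+1); last first.
  by rewrite !timeE; move: n12; rewrite EFinB leeBrDl// lteBlDl.
rewrite timeE [X in _ = X]/= {1}/impulse_point sh /=; congr varphi.
have fn : itime (I (varphi r x)) n \is a fin_num.
  rewrite ge0_fin_numE ?impulse_time_ge0//.
  by have /andP[/le_lt_trans-> //] := n12; rewrite ltry.
by rewrite fineD//= opprD addrA.
Qed.

(** Induction along the impulses of a trajectory: as the impulse times of each
    point are unbounded, a property of [(t, x)] that can be pulled back through
    the first impulse holds for all times. *)
Lemma impulse_ind (P : R -> X -> Prop) :
  (forall t x, 0 <= t -> (t%:E < tau x)%E -> P t x) ->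
  (forall t x r, tau x = r%:E -> r <= t ->
    P (t - r) (I (varphi r x)) -> P t x) ->
  forall t x, 0 <= t -> P t x.
Proof.
move=> Pbefore Pafter t x t0.
have [n tn] := impulse_time_unbounded x t.
elim: n => [|n IH] in x t t0 tn *; first by move: tn; rewrite ltNge lee_fin t0.
have [tx|xt] := ltP t%:E (tau x); first exact: Pbefore.
have [xy|[r tx _]] := tau1_cases x; first by move: xt; rewrite xy leye_eq.
move: xt; rewrite tx lee_fin => rt; apply: (Pafter _ _ r) => //.
apply: IH; first by lra.
by move: tn; rewrite {1}/impulse_time impulse_shift tx /= EFinB lteBlDl.
Qed.

Lemma impulsive_semiflow0 x : phi 0 x = x.
Proof. by rewrite impulsive_before_hit// varphi0. Qed.

Lemma impulsive_semiflowP : semiflow phi.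
Proof.
split=> [|s t x s0 t0]; first exact: impulsive_semiflow0.
elim/impulse_ind : s x / s0 t t0 => [s x s0 sx t t0|s x r tx rs IH t t0].
  rewrite (impulsive_before_hit s0 sx); have tauE := tau1_shift s0 sx.
  have [tsx|xts] := ltP (t + s)%:E (tau x).
    rewrite impulsive_before_hit ?addr_ge0// varphiD// impulsive_before_hit//.
    by rewrite tauE lteBrDr// -EFinD.
  have [xy|[r tx r0]] := tau1_cases x; first by move: xts; rewrite xy leye_eq.
  move: xts sx tauE; rewrite tx lee_fin lte_fin -EFinB => rts sr tauE.
  rewrite (impulsive_after_hit tx)// (impulsive_after_hit tauE); last by lra.
  rewrite -varphiD ?subrK//; last by lra.
  by congr phi; lra.
rewrite (impulsive_after_hit tx rs) -IH// (impulsive_after_hit tx); last by lra.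
by congr phi; lra.
Qed.

(** The compact orbit segment over [0, t], including its initial point, stays away
    from the closed set [D], and so do the segments of nearby points. *)
Lemma tau1_lsc x t : ~ D x -> 0 <= t -> (t%:E < tau x)%E ->
  \forall y \near x, (t%:E < tau y)%E.
Proof.
move=> nDx t0 tx.
have off s : `[0, t]%classic s ->
    \forall p \near (s, x), 0 <= p.1 -> ~ D (varphi p.1 p.2).
  rewrite /= in_itv/= => /andP[s0 st].
  apply: (@varphi_near s x (~` D)) => //; apply: open_nbhs_nbhs.
  split; first exact: closed_openC.
  have [->|sn0] := eqVneq s 0; first by rewrite /= varphi0.
  apply: tau1_nohit; first by rewrite lt_neqAle eq_sym sn0.
  by apply: le_lt_trans tx; rewrite lee_fin.
have /compact_near_coveringP cov := @segment_compact R 0 t.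
have := cov X (nbhs x) (fun y s => 0 <= s -> ~ D (varphi s y)) _ off.
move=> /(_ _)/filterS; apply => y yP; apply: tau1_gt => // s s0 st.
by apply: yP (ltW s0); rewrite /= in_itv/= (ltW s0).
Qed.

(** Before [t] nearby orbits have no impulse either, so that [phi] agrees with
    the continuous semiflow. *)
Lemma impulsive_near_before_hit t x U : ~ D x -> 0 <= t -> (t%:E < tau x)%E ->
  nbhs (varphi t x) U -> \forall p \near (t, x), 0 <= p.1 -> U (phi p.1 p.2).
Proof.
move=> nDx t0 tx nU.
have [t1 tt1 t1x] : exists2 t1, t < t1 & (t1%:E < tau x)%E.
  have [->|[r tr r0]] := tau1_cases x; first by exists (t + 1); [lra|rewrite ltry].
  by move: tx; rewrite tr lte_fin => tr'; exists ((t + r) / 2); rewrite ?lte_fin; lra.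
have n1 : \forall s \near t, s < t1 by exact: lt_nbhsl.
have n2 := tau1_lsc nDx (le_trans t0 (ltW tt1)) t1x.
have n12 : \forall p \near (t, x), p.1 < t1 /\ (t1%:E < tau p.2)%E.
  by exists ([set s | s < t1], [set y | (t1%:E < tau y)%E]) => //= -[? ?] [].
apply: filterS2 n12 (varphi_near t0 nU) => -[s y] /= [st1 t1y] + s0.
move=> /(_ s0); rewrite impulsive_before_hit//.
by apply: lt_trans t1y; rewrite lte_fin.
Qed.

Local Notation Omega := (nonwandering phi).

(** Orbits that start near [x] are carried near [varphi t x]; as [phi t] commutes
    with the flow, a return to a neighbourhood of [x] becomes a return to a
    neighbourhood of [varphi t x]. *)
Lemma nonwandering_before x t : Omega x -> ~ D x -> 0 <= t -> (t%:E < tau x)%E ->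
  Omega (varphi t x).
Proof.
move=> Ox nDx t0 tx U nU T T0.
have [[A B] /= [nA nB] AB] := impulsive_near_before_hit nDx t0 tx nU.
have [s Ts [y [Bsy By]]] := Ox _ nB _ T0.
have s0 : 0 <= s by lra.
have phiU z : B z -> U (phi t z).
  by move=> Bz; apply: (AB (t, z)) => //; split=> //=; exact: nbhs_singleton.
have [_ phiD] := impulsive_semiflowP.
exists s => //; exists (phi t y); split; last exact: phiU.
by rewrite /= -phiD// addrC phiD//; exact: phiU.
Qed.

Lemma nonwandering_hit x r : Omega x -> ~ D x -> tau x = r%:E ->
  Omega (varphi r x).
Proof.
move=> Ox nDx tx; have [r0 _] := tau1_hit tx.
apply: nonwandering_closed => U nU.
have [e /= e0 re] := varphi_near_time (ltW r0) nU.
have [s [s0 sr res]] : exists s, [/\ 0 <= s, s < r & `|r - s| < e].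
  (* any time in [0, r) at distance less than e from r would do *)
  exists (Num.max 0 (r - e / 2)); rewrite le_max lexx/= gt_max r0/=.
  have [h|h] := leP 0 (r - e / 2).
    by split=> //; [lra|rewrite ltr_norml; apply/andP; split; lra].
  by split=> //; [lra|rewrite ltr_norml; apply/andP; split; lra].
exists (varphi s x); split; last exact: re.
by apply: nonwandering_before => //; rewrite tx lte_fin.
Qed.

Context (impulse_in : I @` (Omega `&` D) `<=` Omega `\` D).

(** An orbit of [Omega \ D] meets [D] only at its hitting times, where the
    impulse takes it back to [Omega \ D]. *)
Lemma nonwandering_invariant t x : 0 <= t ->
  (Omega `\` D) x -> (Omega `\` D) (phi t x).
Proof.
move: t x; apply: impulse_ind => [t x t0 tx [Ox nDx]|t x r tx rt IH [Ox nDx]].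
  rewrite impulsive_before_hit//; split; first exact: nonwandering_before.
  have [->|tn0] := eqVneq t 0; first by rewrite varphi0.
  by apply: tau1_nohit => //; rewrite lt_neqAle eq_sym tn0.
rewrite (impulsive_after_hit tx rt); apply: IH; apply: impulse_in; exists (varphi r x) => //.
by split; [exact: nonwandering_hit|have [] := tau1_hit tx].
Qed.

(** ** Continuity of the glued semiflow *)

(* [q] stands for the quotient map that identifies [x] with [I x]; [rho x] is the
   representative off [D] of the class of [x]. *)
Context (tau_cont : {within Omega, continuous (tauD varphi D)}).
Context (I_cont : {within D, continuous I}).
Context {Y : topologicalType} (q : X -> Y).
Context (q_cont : {within Omega, continuous q}).
Context (q_glue : {in Omega `&` D, forall x, q x = q (I x)}).

Let rho x := if x \in D then I x else x.
Let G t x := q (phi t (rho x)).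

Let rho_in x : Omega x -> (Omega `\` D) (rho x).
Proof.
move=> Ox; rewrite /rho; case: ifPn => [/set_mem Dx|/negP nDx].
  by apply: impulse_in; exists x.
by split=> // /mem_set.
Qed.

Let rho_out x : ~ D x -> rho x = x.
Proof. by move=> nDx; rewrite /rho memNset. Qed.

Let Gcont t x := forall U, nbhs (G t x) U ->
  \forall p \near (t, x), 0 <= p.1 -> Omega p.2 -> U (G p.1 p.2).

Let q_near x U : Omega x -> nbhs (q x) U -> \forall y \near x, Omega y -> U (q y).
Proof. by move=> Ox nU; have /subspace_continuousP/(_ x Ox U nU) := q_cont. Qed.

Let tauD_before t x : 0 <= t -> (t%:E < tauD varphi D x)%E ->
  ~ D x /\ (t%:E < tau x)%E.
Proof.
move=> t0; rewrite /tauD; case: ifPn => [_|/negP nDx tx].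
  by rewrite lte_fin ltNge t0.
by split=> // /mem_set.
Qed.

Let tauD_after x r : Omega x -> tauD varphi D x = r%:E ->
  [/\ 0 <= r, (Omega `&` D) (varphi r x) &
      forall t, r <= t -> phi t (rho x) = phi (t - r) (I (varphi r x))].
Proof.
move=> Ox; rewrite /tauD /rho; case: ifPn => [/set_mem Dx [<-]|/negP nDx tx].
  by rewrite varphi0; split=> // t _; rewrite subr0.
have nDx' : ~ D x by move=> /mem_set.
have [r0 Dr] := tau1_hit tx.
split; [exact: ltW|by split=> //; exact: nonwandering_hit|].
by move=> t; exact: impulsive_after_hit.
Qed.

Let G_before t x : 0 <= t -> Omega x -> (t%:E < tauD varphi D x)%E -> Gcont t x.
Proof.
move=> t0 Ox tx U; have [nDx ttau] := tauD_before t0 tx.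
rewrite /G rho_out// impulsive_before_hit// => nU.
have Ot : Omega (varphi t x) by exact: nonwandering_before.
have near1 := impulsive_near_before_hit nDx t0 ttau (q_near Ot nU).
have nD : \forall y \near x, ~ D y.
  by apply: open_nbhs_nbhs; split=> //; exact: closed_openC.
have near2 : \forall p \near (t, x), ~ D p.2.
  by exists (setT, ~` D) => [|p []//]; split=> //; exact: filterT.
apply: filterS2 near1 near2 => -[s y] /= Vs nDy s0 Oy.
rewrite rho_out//; apply: Vs => //.
by have [] := nonwandering_invariant s0 (conj Oy nDy).
Qed.

(** A jump at time [r] sends nearby orbits to nearby orbits because the jump
    time of nearby points is close to [r]. When [t = r], a nearby orbit may not
    have jumped yet; it is then close to [varphi r x], which [q] identifies with
    its image under [I]. *)
Let G_after t x r : Omega x -> tauD varphi D x = r%:E -> r <= t ->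
  Gcont (t - r) (I (varphi r x)) -> Gcont t x.
Proof.
move=> Ox xr rt Gz U.
have [r0 ODe jump] := tauD_after Ox xr.
have [Oz nDz] : (Omega `\` D) (I (varphi r x)) by apply: impulse_in; exists (varphi r x).
have -> : G t x = G (t - r) (I (varphi r x)) by rewrite /G jump// rho_out.
move=> nU; have [[W1 W2] /= [nW1 nW2] WU] := Gz _ nU.
have [e1 /= e10 W1e] := nW1.
have nW3 : \forall w \near varphi r x, D w -> W2 (I w).
  by have /subspace_continuousP/(_ _ ODe.2 _ nW2) := I_cont.
have [[N1 N2] /= [nN1 nN2] NW3] := varphi_near r0 nW3.
have [e [e0 ee1 late]] : exists e, [/\ 0 < e, e <= e1 / 2 &
    \forall p \near (t, x), forall r' : R, `|r - r'| < e -> 0 <= p.1 ->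
      Omega p.2 -> ~ D p.2 -> (p.1%:E < tau p.2)%E -> p.1 < r' ->
      U (q (varphi p.1 p.2))].
  (* [late] is about orbits that have not jumped yet at time [p.1]. *)
  have [rt'|tr] := ltP r t; last first.
    exists (e1 / 2); split=> //; first by lra.
    have tE : t = r by apply/eqP; rewrite eq_le tr rt.
    subst t; have nUe : nbhs (q (varphi r x)) U.
      by rewrite q_glue ?inE//; move: nU; rewrite /G subrr rho_out// impulsive_semiflow0.
    apply: filterS (varphi_near r0 (q_near ODe.1 nUe)).
    move=> -[s y] /= Vs r' _ s0 Oy nDy sy _.
    by apply: Vs => //; exact: nonwandering_before.
  (* if r < t, then nearby orbits have all jumped: r' < (t + r) / 2 < p.1 *)
  exists (Num.min (e1 / 2) ((t - r) / 2)); rewrite lt_min ge_min lexx.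
  split=> //; first by apply/andP; split; lra.
  have nt : \forall s \near t, (t + r) / 2 < s by apply: lt_nbhsr; lra.
  exists ([set s | (t + r) / 2 < s], setT) => [|[s y] /= [ts _] r' + _ _ _ _ sr'].
    by split=> //; exact: filterT.
  by rewrite lt_min !ltr_norml => /andP[/andP[h1 h2] /andP[h3 h4]]; clear xr; lra.
have near_tau : \forall y \near x, Omega y ->
    exists r', [/\ tauD varphi D y = r'%:E, `|r - r'| < e & N1 r'].
  have nr : nbhs r%:E [set z | exists r', [/\ z = r'%:E, `|r - r'| < e & N1 r']].
    apply/nbhs_EFin; have nre : \forall r' \near r, `|r - r'| < e by exists e.
    by apply: filterS2 nre nN1 => r' rr' Nr'; exists r'.
  by rewrite -xr in nr; have /subspace_continuousP/(_ x Ox _ nr) := tau_cont.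
have near_t : \forall s \near t, `|t - s| < e1 / 2 by exists (e1 / 2) => //=; lra.
have near_p : \forall p \near (t, x), [/\ `|t - p.1| < e1 / 2, N2 p.2 &
    Omega p.2 -> exists r', [/\ tauD varphi D p.2 = r'%:E, `|r - r'| < e & N1 r']].
  exists ([set s | `|t - s| < e1 / 2], N2 `&` [set y | Omega y ->
    exists r', [/\ tauD varphi D y = r'%:E, `|r - r'| < e & N1 r']]) => /=.
    by split=> //; exact: filterI.
  by move=> [s y] /= [? []].
apply: filterS2 late near_p => -[s y] /= late [ts N2y tauy] s0 Oy.
have [r' [yr' rr' Nr']] := tauy Oy.
have [r's|sr'] := leP r' s; last first.
  have [|nDy sy] := @tauD_before s y s0; first by rewrite yr' lte_fin.
  by rewrite /G rho_out// impulsive_before_hit//; exact: (late r').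
have [r'0 ODw jump'] := tauD_after Oy yr'; rewrite /G jump'//.
have [Ow nDw] : (Omega `\` D) (I (varphi r' y)) by apply: impulse_in; exists (varphi r' y).
have := WU (s - r', I (varphi r' y)); rewrite /= /G rho_out//; apply=> //; last by lra.
split; last by apply: (NW3 (r', y)) => //; case: ODw.
apply: W1e; rewrite /ball_/=.
move: ts rr'; rewrite !ltr_norml => /andP[h1 h2] /andP[h3 h4].
by apply/andP; split; lra.
Qed.

(** Continuity propagates along the impulses of an orbit of [Omega \ D]. *)
Let G_cont_off t x : 0 <= t -> (Omega `\` D) x -> Gcont t x.
Proof.
move: t x; apply: impulse_ind => [t x t0 tx [Ox nDx]|t x r tx rt IH [Ox nDx]].
  by apply: G_before => //; rewrite /tauD memNset.
apply: (@G_after t x r) => //; first by rewrite /tauD memNset.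
apply: IH; apply: impulse_in; exists (varphi r x) => //.
by split; [exact: nonwandering_hit|have [] := tau1_hit tx].
Qed.

(** A point of [D] counts as jumping at time [0], so it is covered by the case of
    a jump. *)
Lemma glued_flow_near t x U : 0 <= t -> Omega x -> nbhs (q (phi t (rho x))) U ->
  \forall p \near (t, x), 0 <= p.1 -> Omega p.2 -> U (q (phi p.1 (rho p.2))).
Proof.
move=> t0 Ox; have [Dx|nDx] := pselect (D x); last exact: G_cont_off.
apply: (@G_after t x 0) => //; first by rewrite /tauD mem_set.
by rewrite subr0 varphi0; apply: G_cont_off => //; apply: impulse_in; exists x.
Qed.

(** ** Measurability of the impulsive semiflow *)

Context (scX : @second_countable X).

(** If the orbit of a point misses [D] during [a, b], so do the orbits of the
    points nearby, by compactness of [a, b]. *)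
Lemma closed_visit a b : 0 <= a ->
  closed [set x | exists t, [/\ a <= t, t <= b & D (varphi t x)]].
Proof.
move=> a0; rewrite -openC openE => x nx; rewrite /interior.
have off t : `[a, b]%classic t ->
    \forall p \near (t, x), 0 <= p.1 -> ~ D (varphi p.1 p.2).
  rewrite /= in_itv/= => /andP[ta tb].
  apply: (@varphi_near t x (~` D)); first exact: le_trans ta.
  apply: open_nbhs_nbhs; split; first exact: closed_openC.
  by move=> Dt; apply: nx; exists t.
have /compact_near_coveringP cov := @segment_compact R a b.
have := cov X (nbhs x) (fun y s => 0 <= s -> ~ D (varphi s y)) _ off.
move=> /(_ _)/filterS; apply => y yP [t [ta tb Dt]].
by apply: (yP t) Dt; [rewrite /= in_itv/= ta|exact: le_trans ta].
Qed.

(** A passage time less than [r] leaves room for a margin [1 / (n + 1)] on both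
    sides, as it is positive; the margins make the sets of visits closed. *)
Lemma borel_tau_lt r : borel [set x | (tau x < r%:E)%E].
Proof.
rewrite (_ : [set _ | _] = \bigcup_n
  [set x | exists t, [/\ n.+1%:R^-1 <= t, t <= r - n.+1%:R^-1 & D (varphi t x)]]).
  by apply borel_bigcup => n; apply borel_closed; exact: closed_visit.
apply/seteqP; split=> [x /= xr|x [n _ [t [nt tr Dt]]] /=]; last first.
  have n0 : 0 < n.+1%:R^-1 :> R by [].
  apply: (@le_lt_trans _ _ t%:E); last first.
    by rewrite lte_fin (le_lt_trans tr)// ltrBlDr ltrDl.
  by apply: ereal_inf_lbound; exists t => //; split=> //; exact: lt_le_trans nt.
have [xy|[t xt t0]] := tau1_cases x; first by move: xr; rewrite xy.
move: xr; rewrite xt lte_fin => tr; have [_ Dt] := tau1_hit xt.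
pose m := Num.min t (r - t); have m0 : 0 < m by rewrite lt_min t0; lra.
have [//|n nm] := @ltr_add_invr R 0 m; rewrite add0r in nm.
have [mt mr] : m <= t /\ m <= r - t by rewrite !ge_min !lexx orbT.
exists n => //; exists t; split=> //; first exact: le_trans (ltW nm) mt.
by rewrite lerBrDl -lerBrDr (le_trans (ltW nm)).
Qed.

(* Times and points of the first impulse are meaningful where [tau] is finite. *)
Let finite_tau := [set x | (tau x < +oo)%E].
Let ftau x := fine (tau x).

Let ftauE x : finite_tau x -> tau x = (ftau x)%:E /\ 0 < ftau x.
Proof.
rewrite /finite_tau /ftau /=; have [->//|[r -> r0] _] := tau1_cases x.
by [].
Qed.

Let borel_finite_tau : borel finite_tau.
Proof.
rewrite (_ : finite_tau = \bigcup_n [set x | (tau x < n%:R%:E)%E]).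
  by apply borel_bigcup => n; exact: borel_tau_lt.
apply/seteqP; split=> [x /ftauE[xt t0]|x [n _ /= xn]]; last first.
  by rewrite /finite_tau /=; apply: (lt_trans xn); rewrite ltry.
exists (Num.truncn (ftau x)).+1 => //=; rewrite xt lte_fin; exact: truncnS_gt.
Qed.

Let borel_ftau : borel_fun finite_tau ftau.
Proof.
apply: borel_fun_lt => // r; rewrite (_ : _ `&` _ = [set x | (tau x < r%:E)%E]).
  exact: borel_tau_lt.
apply/seteqP; split=> [x /= [/ftauE[-> _]]//|x /= xr].
have xf : finite_tau x by apply: (lt_trans xr); rewrite ltry.
by split=> //; have [xt _] := ftauE xf; rewrite xt lte_fin in xr.
Qed.

Let past := [set p : R * X | 0 <= p.1].

Let borel_varphi : borel_fun past (fun p => varphi p.1 p.2).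
Proof. exact: borel_fun_continuous (borel_closed (@closed_nonneg_time R X)) (proj2 flow). Qed.

Let hit x := varphi (ftau x) x.

Let borel_hit : borel_fun finite_tau (I \o hit).
Proof.
apply: (@borel_fun_comp _ _ _ _ D).
- apply: (@borel_fun_comp X (R * X)%type X finite_tau past (fun x => (ftau x, x))
    (fun p => varphi p.1 p.2)).
  + apply: borel_fun_pair => //; first exact: real_second_countable.
    by apply: borel_fun_continuous => // ; apply: continuous_subspaceT => x; exact: cvg_id.
  + exact: borel_varphi.
  + by move=> _ [x xf <-] /=; have [_ /ltW] := ftauE xf.
- by apply: borel_fun_continuous => //; apply borel_closed.
- by move=> _ [x xf <-]; have [/tau1_hit[_]] := ftauE xf.
Qed.

Let time_after_jump (p : R * X) := p.1 - ftau p.2.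
Let jumped := [set p : R * X | finite_tau p.2] `&` time_after_jump @^-1` [set t | 0 <= t].

Let borel_snd : borel_fun [set p : R * X | finite_tau p.2] snd.
Proof.
have b2 : borel_fun [set: R * X] snd.
  apply: borel_fun_continuous; first exact: borelT.
  by apply: continuous_subspaceT => p; exact: cvg_snd.
have bE := b2 _ borel_finite_tau; rewrite setTI in bE.
exact: borel_fun_sub b2 (@subsetT _ _) bE.
Qed.

Let borel_time_after_jump : borel_fun [set p : R * X | finite_tau p.2] time_after_jump.
Proof.
have bE := borel_fun_dom borel_snd.
apply: (@borel_fun_comp (R * X)%type (R * R)%type R _ setT (fun p : R * X => (p.1, ftau p.2))
  (fun z : R * R => z.1 - z.2)) => //.
- apply: borel_fun_pair; [exact: real_second_countable|exact: real_second_countable| |].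
    by apply: borel_fun_continuous => //; apply: continuous_subspaceT => p; exact: cvg_fst.
  by apply: borel_fun_comp borel_snd borel_ftau _ => _ [p pf <-].
- apply: borel_fun_continuous; first exact: borelT.
  apply: continuous_subspaceT => p; apply: cvgB; [exact: cvg_fst|exact: cvg_snd].
Qed.

Let borel_jumped : borel jumped.
Proof. by apply: borel_time_after_jump; apply borel_closed; exact: closed_ge. Qed.

Let shift (p : R * X) := (time_after_jump p, (I \o hit) p.2).

Let borel_shift : borel_fun jumped shift.
Proof.
have sub : jumped `<=` [set p | finite_tau p.2] by move=> p [].
apply: borel_fun_pair; [exact: real_second_countable|exact: scX| |].
  exact: borel_fun_sub borel_time_after_jump sub _.
have := borel_fun_sub borel_snd sub borel_jumped => b2.
by apply: (borel_fun_comp b2 borel_hit) => _ [p [pf _] <-].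
Qed.

Let upto n := [set p : R * X | 0 <= p.1 /\ (p.1%:E < itime p.2 n)%E].

Let jumpedP t x : jumped (t, x) <-> exists2 r, tau x = r%:E & r <= t.
Proof.
split=> [[xf /= rt]|[r xr rt]].
  by have [xr _] := ftauE xf; exists (ftau x); rewrite // -subr_ge0.
have xf : finite_tau x by rewrite /finite_tau /= xr ltry.
by split=> //=; rewrite /time_after_jump /ftau /= xr subr_ge0.
Qed.

(** Up to the [n.+1]-st impulse, the semiflow is [varphi] before the first
    impulse and, after it, the semiflow up to the [n]-th impulse composed with
    the Borel map [shift]. *)
Let borel_upto n B : borel B ->
  borel (upto n `&` (fun p => phi p.1 p.2) @^-1` B).
Proof.
move=> bB; elim: n => [|n IH].
  rewrite (_ : _ `&` _ = set0); first exact: borel0.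
  by apply/seteqP; split=> // -[t x] /= [[/= t0]]; rewrite ltNge lee_fin t0.
rewrite (_ : _ `&` _ =
  ((past `&` (fun p => varphi p.1 p.2) @^-1` B) `\` jumped) `|`
  (jumped `&` shift @^-1` (upto n `&` (fun p => phi p.1 p.2) @^-1` B))).
  apply borelU; first by apply borelD => //; exact: borel_varphi.
  exact: borel_shift.
have timeS x r : tau x = r%:E -> itime x n.+1 = (r%:E + itime (I (varphi r x)) n)%E.
  by move=> xr; rewrite {1}/impulse_time impulse_shift xr.
have before t x : ~ jumped (t, x) -> (t%:E < tau x)%E.
  move=> nj; rewrite ltNge; apply/negP => xt; apply/nj/jumpedP.
  have [xy|[r xr _]] := tau1_cases x; first by move: xt; rewrite xy leye_eq.
  by exists r; rewrite // -lee_fin -xr.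
apply/seteqP; split=> -[t x] /=.
  move=> [[t0 tn] Bphi]; have [j|nj] := pselect (jumped (t, x)); last first.
    by left; split=> //; split=> //; rewrite -impulsive_before_hit//; exact: before.
  have /jumpedP[r xr rt] := j; right; split=> //.
  rewrite /shift /time_after_jump /hit /ftau /= xr /=; split; last by rewrite -impulsive_after_hit.
  split; first by rewrite /= subr_ge0.
  by rewrite /= EFinB lteBlDl// -timeS.
move=> [[[t0 Bv] nj]|[j]].
  have tx := before _ _ nj; rewrite /= in t0.
  rewrite impulsive_before_hit//; split=> //; split=> //.
  apply: (lt_le_trans tx); have := impulse_time_le x (ltn0Sn n).
  by rewrite /impulse_time /= add0e.
have /jumpedP[r xr rt] := j.
rewrite /shift /time_after_jump /hit /ftau /= xr /= => -[[/= rt' tn] Bphi].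
have r0 : 0 < r by have [] := tau1_hit xr.
split; last by rewrite (impulsive_after_hit xr).
by split; [exact: le_trans (ltW r0) rt|rewrite (timeS _ _ xr) -lteBlDl// -EFinB].
Qed.

Lemma borel_impulsive_semiflow : borel_fun past (fun p => phi p.1 p.2).
Proof.
move=> B bB; rewrite (_ : _ `&` _ =
  \bigcup_n (upto n `&` (fun p => phi p.1 p.2) @^-1` B)).
  by apply borel_bigcup => n; exact: borel_upto.
apply/seteqP; split=> [[t x] [/= t0 Bphi]|[t x] [n _ [[/= t0 _] Bphi]]//].
by have [n tn] := impulse_time_unbounded x t; exists n.
Qed.

End impulsive_flow.

(** A compact space carries recurrence: an accumulation point of the orbit
    sampled at integer times is non-wandering. *)
Lemma nonwandering_nonempty (R : realType) (Z : ptopologicalType)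
    (phi : R -> Z -> Z) :
  compact [set: Z] -> semiflow phi -> nonwandering phi !=set0.
Proof.
move=> cZ [_ phiD].
pose u (n : nat) := phi n%:R point.
have [p [_ clp]] := cZ (u @ \oo) _ filterT.
exists p => U nU T T0.
have [x [[n _ unx] Ux]] := clp [set u n | n in setT] U
  (filterS (fun n _ => ex_intro2 _ _ n I erefl) filterT) nU.
have [N TN] : exists N, T <= N%:R.
  by exists (Num.truncn T).+1; rewrite ltW// truncnS_gt.
have tail : (u @ \oo) [set u k | k in [set k | (n + N <= k)%N]].
  by exists (n + N)%N => // k nk; exists k.
have [y [[k nk uky] Uy]] := clp _ U tail nU.
have nk' : (n <= k)%N by rewrite (leq_trans _ nk)// leq_addr.
exists (k - n)%:R.
  by rewrite (le_trans TN)// ler_nat leq_subRL.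
exists x; split=> //=.
by rewrite -unx /u -phiD ?ler0n// -natrD subnK// -/(u k) uky.
Qed.

(** * Gluing a compact metric space along a continuous map *)

(** An alias of [T] without its structures beyond choice, to be given a new metric. *)
Definition remetrized (T : choiceType) : Type := T.
HB.instance Definition _ (T : choiceType) := Choice.copy (remetrized T) T.

Section function_metric.
Context {R : realType} (T : choiceType) (t0 : T) (J : Type) (j0 : J).
Context (F : J -> T -> R).
Context (F1 : forall j t, `|F j t| <= 1).
Context (Fsep : forall s t, (forall j, F j s = F j t) -> s = t).

Let gaps (s t : T) : set R := [set `|F j s - F j t| | j in [set: J]].
Let dist (s t : T) : R := sup (gaps s t).

Let gaps_has_sup s t : has_sup (gaps s t).
Proof.
split; first by exists `|F j0 s - F j0 t|, j0.
exists 2 => _ [j _ <-]; apply: (le_trans (ler_normB _ _)).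
by have := F1 j s; have := F1 j t; lra.
Qed.

Let gap_dist j s t : `|F j s - F j t| <= dist s t.
Proof. by apply: ub_le_sup; [case: (gaps_has_sup s t)|exists j]. Qed.

Let dist_le s t (e : R) : (forall j, `|F j s - F j t| <= e) -> dist s t <= e.
Proof.
by move=> ge; apply: ge_sup; [case: (gaps_has_sup s t)|move=> _ [j _ <-]].
Qed.

Let distxx t : dist t t = 0.
Proof.
apply/eqP; rewrite eq_le; apply/andP; split.
  by apply: dist_le => j; rewrite subrr normr0.
exact: le_trans (gap_dist j0 t t).
Qed.

Let dist_eq0 s t : dist s t = 0 -> s = t.
Proof.
move=> d0; apply: Fsep => j; apply/eqP; rewrite -subr_eq0 -normr_le0 -d0.
exact: gap_dist.
Qed.

Let dist_sym s t : dist s t = dist t s.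
Proof.
by apply/eqP; rewrite eq_le; apply/andP; split; apply: dist_le => j;
  rewrite distrC; exact: gap_dist.
Qed.

Let dist_triangle t s r : dist s r <= dist s t + dist t r.
Proof.
apply: dist_le => j; apply: le_trans (ler_distD (F j t) _ _) _.
exact: lerD (gap_dist _ _ _) (gap_dist _ _ _).
Qed.

(** The distance is the supremum of the differences of the functions: it is finite
    because they are bounded and positive because they separate points. *)
Lemma function_metric : exists (Y : pmetricType R) (u : T -> Y) (v : Y -> T),
  [/\ cancel u v, cancel v u &
    forall s t (e : R), (forall j, `|F j s - F j t| <= e) -> mdist (u s) (u t) <= e].
Proof.
pose p := isPointed.Build (remetrized T) t0.
pose m := isMetric.Build R (remetrized T) distxx dist_eq0 dist_sym dist_triangle.
pose Y : pmetricType R := HB.pack_for (pmetricType R) (remetrized T) p m.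
exists Y, id, id; split=> // s t e; exact: dist_le.
Qed.

End function_metric.

(** Choosing a point in each nonempty set of a countable base. *)
Lemma dense_sequence (R : realType) (X : pmetricType R) : compact [set: X] ->
  exists z : nat -> X, forall (x : X) (U : set X), nbhs x U -> exists n, U (z n).
Proof.
move=> /compact_second_countable[B cB [oB bB]].
have [f fB] := countable_enum set0 cB.
exists (fun n => xget point (f n)) => x U nU.
have [V [BV Vx] VU] := bB _ _ nU.
have [n fn] := fB _ BV; exists n; rewrite fn; apply: VU.
by apply: xgetPex; exists x.
Qed.

Lemma min_lip {R : realDomainType} (c a b : R) :
  `|Num.min c a - Num.min c b| <= `|a - b|.
Proof.
rewrite ler_norml; have := ler_norm (a - b); have := ler_norm (b - a).
rewrite (distrC b) !minEle => h1 h2.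
by have [h3|h3] := leP c a; have [h4|h4] := leP c b; apply/andP; split; lra.
Qed.

Lemma max_lip {R : realDomainType} (c a b : R) :
  `|Num.max c a - Num.max c b| <= `|a - b|.
Proof.
rewrite ler_norml; have := ler_norm (a - b); have := ler_norm (b - a).
rewrite (distrC b) !maxEle => h1 h2.
by have [h3|h3] := leP c a; have [h4|h4] := leP c b; apply/andP; split; lra.
Qed.

Section mdist_continuity.
Context {R : realType} {X : metricType R}.

Lemma mdist_lip (x y z : X) : `|mdist x z - mdist y z| <= mdist x y.
Proof.
have := metric_triangle x y z; have := metric_triangle y x z.
by rewrite (metric_sym y x) ler_norml => ? ?; apply/andP; split; lra.
Qed.

Lemma near_mdist (x : X) (e : R) : 0 < e -> \forall y \near x, mdist x y < e.
Proof. by move=> e0; have := nbhsx_ballx x e e0; rewrite ballEmdist. Qed.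

Lemma mdist_continuous (z : X) : continuous (fun x => Num.min 1 (mdist x z) : R).
Proof.
move=> x; apply/cvgrPdist_lt => e e0; apply: filterS (near_mdist x e0) => y.
apply: le_lt_trans; apply: le_trans (min_lip _ _ _) _; exact: mdist_lip.
Qed.

End mdist_continuity.

Section gluing.
Context {R : realType} {X : pmetricType R} (A E : set X) (g : X -> X).
Context (cX : compact [set: X]) (clE : closed E).
Context (cg : {within E, continuous g}) (gE : g @` E `<=` A `\` E).

(* The points that are identified with another one lie in the closed set [C]. *)
Let K := g @` E.
Let C := E `|` K.

Let cptE : compact E.
Proof. exact: subclosed_compact clE cX _. Qed.

Let clK : closed K.
Proof.
apply: compact_closed; first exact: metric_hausdorff.
exact: continuous_compact.
Qed.

Let clC : closed C.
Proof. exact: closedU clE clK. Qed.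

Let rho x := if x \in E then g x else x.

Let rho_continuous : {within C, continuous rho}.
Proof.
apply: withinU_continuous => //.
  apply: (@subspace_eq_continuous _ _ _ g) cg => x xE.
  by rewrite /from_subspace /= /rho xE.
apply: (@subspace_eq_continuous _ _ _ (@id X)).
  move=> x /set_mem Kx; rewrite /from_subspace /= /rho memNset//.
  by move=> Ex; have [] := gE Kx.
by apply: continuous_subspaceT => x; exact: cvg_id.
Qed.

(** By Tietze's theorem: as [E] and [K] are disjoint, [rho] is continuous on [C].
    Since [rho] takes the same value at [x] and [g x] for [x] in [E], so does the
    extension. *)
Let extension z : exists f : X -> R,
  [/\ continuous f, (forall x, `|f x| <= 1) &
      forall x, C x -> f x = Num.min 1 (mdist (rho x) z)].
Proof.
have [|||f [fC cf f1]] := @continuous_bounded_extension X R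
  (compact_normal (@metric_hausdorff R X) cX) C clC
  (fun x => Num.min 1 (mdist (rho x) z)) 1.
- by [].
- move=> x; apply: (@continuous_comp (subspace C) X R^o rho
    (fun y => Num.min 1 (mdist y z))); first exact: rho_continuous.
  exact: mdist_continuous.
- move=> x _; rewrite ger0_norm ?ge_min ?lexx// le_min ler01; exact: mdist_ge0.
by exists f; split=> // x Cx; rewrite fC ?inE.
Qed.

(** Tents with support off [C]; they separate the points that are not glued. *)
Let tent (p : X * R) x : R :=
  if `[< p.2 <= 1 /\ forall c, C c -> p.2 <= mdist c p.1 >]
  then Num.max 0 (p.2 - mdist x p.1) else 0.

Let tent_C p c : C c -> tent p c = 0.
Proof.
move=> Cc; rewrite /tent; case: asboolP => // -[_ /(_ _ Cc) pc].
by rewrite maxEle; case: leP => //; lra.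
Qed.

Let tent_le1 p x : `|tent p x| <= 1.
Proof.
rewrite /tent; case: asboolP => [[p1 _]|_]; last by rewrite normr0.
rewrite ger0_norm ?le_max ?lexx// ge_max ler01/=.
by have := mdist_ge0 x p.1; lra.
Qed.

Let tent_lip p x y : `|tent p x - tent p y| <= mdist x y.
Proof.
rewrite /tent; case: asboolP => _; last by rewrite subrr normr0 mdist_ge0.
apply: le_trans (max_lip _ _ _) _.
have -> : p.2 - mdist x p.1 - (p.2 - mdist y p.1) = - (mdist x p.1 - mdist y p.1) by lra.
by rewrite normrN mdist_lip.
Qed.

Let tent_sep x y : ~ C x -> x != y -> exists p, tent p x != tent p y.
Proof.
move=> nCx xy.
have /nbhs_ballP[e /= e0 xeC] : nbhs x (~` C).
  by apply: open_nbhs_nbhs; split=> //; exact: closed_openC.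
pose r := Num.min 1 (Num.min e (mdist x y)).
have r0 : 0 < r by rewrite !lt_min ltr01 e0 mdist_gt0.
exists (x, r); rewrite /tent asboolT/=; last first.
  split=> [|c Cc]; first by rewrite ge_min lexx.
  rewrite leNgt metric_sym; apply/negP => xcr; apply: (xeC c) => //.
  by rewrite ballEmdist/=; apply: (lt_le_trans xcr); rewrite !ge_min lexx orbT.
rewrite mdistxx subr0 (max_r (ltW r0)) max_l ?gt_eqF//.
by rewrite subr_le0 metric_sym !ge_min lexx !orbT.
Qed.

Context (z : nat -> X) (zdense : forall (x : X) (U : set X), nbhs x U -> exists n, U (z n)).

Let ext n := sval (cid (extension (z n))).

(* The tents separate the points off [C] from all others, the extensions separate
   the points of [K]. The factors [1 / (n + 1)] make the family equicontinuous:
   only finitely many extensions matter for a given precision. *)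
Let F (j : (X * R) + nat) (x : X) : R :=
  match j with inl p => tent p x | inr n => n.+1%:R^-1 * ext n x end.

Let F_le1 j x : `|F j x| <= 1.
Proof.
case: j => [p|n] /=; first exact: tent_le1.
rewrite normrM ger0_norm// mulr_ile1 ?invr_le1 ?unitfE ?ler1n//.
by rewrite /ext; case: cid => f [].
Qed.

Let F_rho j x : E x -> F j x = F j (g x).
Proof.
move=> Ex; have Kgx : K (g x) by exists x.
case: j => [p|n] /=; first by rewrite !tent_C//; [right|left].
rewrite /ext; case: cid => f /= [_ _ fC]; rewrite !fC; [|by right|by left].
congr (_ * Num.min _ (mdist _ _)); rewrite /rho mem_set// memNset//.
by have [] := gE Kgx.
Qed.

(* For two points of [K], take [z n] so close to [x] that the truncated distances
   from [x] and [y] to [z n] differ. *)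
Let F_sep x y : ~ E x -> ~ E y -> (forall j, F j x = F j y) -> x = y.
Proof.
move=> nEx nEy Fxy; apply/eqP/negPn/negP => xy.
have Cx : C x.
  by apply: contrapT => /tent_sep/(_ xy)[p]; have /= -> := Fxy (inl p); rewrite eqxx.
have Cy : C y.
  have yx : y != x by rewrite eq_sym.
  apply: contrapT => /tent_sep/(_ yx)[p].
  by have /= -> := Fxy (inl p); rewrite eqxx.
pose r := Num.min 1 (mdist x y) / 2.
have r0 : 0 < r by rewrite divr_gt0// lt_min ltr01 mdist_gt0.
have [n xzn] := zdense (near_mdist x r0).
have := Fxy (inr n); rewrite /= /ext; case: cid => f /= [_ _ fC].
move=> /(mulfI _); rewrite invr_eq0 pnatr_eq0 => /(_ isT).
rewrite !fC// /rho !memNset//.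
have h1 : 2 * r <= 1 by rewrite /r mulrC divfK ?ge_min ?lexx.
have h2 : 2 * r <= mdist x y by rewrite /r mulrC divfK ?ge_min ?lexx ?orbT.
have := metric_triangle x (z n) y; rewrite (metric_sym (z n) y).
rewrite !minEle => h3.
by have [h4|h4] := leP 1 (mdist x (z n)); have [h5|h5] := leP 1 (mdist y (z n)); lra.
Qed.

(* Equicontinuity makes the quotient map continuous for the supremum metric. *)
Let F_equicontinuous x (e : R) : 0 < e ->
  \forall y \near x, forall j, `|F j x - F j y| <= e.
Proof.
move=> e0; pose N := (Num.truncn (2 / e)).+1.
have ne : forall n, (n < N)%N -> \forall y \near x, `|F (inr n) x - F (inr n) y| <= e.
  move=> n _; rewrite /F /ext; case: cid => f /= [cf _ _].
  have /cvgrPdist_lt/(_ _ e0) := cf x; apply: filterS => y /ltW.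
  rewrite -mulrBr normrM ger0_norm//; apply: le_trans.
  by rewrite ler_piMl// invr_le1 ?unitfE ?ler1n.
have near_small : \forall y \near x, forall n, (n < N)%N -> `|F (inr n) x - F (inr n) y| <= e.
  elim: N ne => [_|k IH ne]; first exact: filterE.
  apply: filterS2 (IH (fun n nk => ne n (ltnW nk))) (ne k (leqnn _)) => y yk xk n.
  by rewrite ltnS leq_eqVlt => /predU1P[->//|]; exact: yk.
apply: filterS2 near_small (near_mdist x e0) => y small xye [p|n].
  exact: le_trans (tent_lip _ _ _) (ltW xye).
have [nN|Nn] := ltnP n N; first exact: small.
have n2e : 2 / e <= n.+1%:R.
  apply: (le_trans (ltW (truncnS_gt _))); rewrite ler_nat; exact: leqW.
have ext1 w : `|ext n w| <= 1 by rewrite /ext; case: cid => f [].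
rewrite /= -mulrBr normrM ger0_norm// ler_pdivrMl//.
apply: (@le_trans _ _ 2); last by rewrite -ler_pdivrMr.
apply: (le_trans (ler_normB _ _)).
by have := ext1 x; have := ext1 y; lra.
Qed.

Let rho_in x : A x -> (A `\` E) (rho x).
Proof.
move=> Ax; rewrite /rho; case: ifPn => [/set_mem Ex|/negP xE]; first by apply: gE; exists x.
by split=> // /mem_set.
Qed.

Lemma gluing_from_dense : (A `\` E) !=set0 ->
  exists (Y : pmetricType R) (q : X -> Y) (s : Y -> X),
    [/\ {within A, continuous q}, (forall y, (A `\` E) (s y)), cancel s q,
      {in A `\` E, cancel q s} & {in E, forall x, q x = q (g x)}].
Proof.
move=> [x0 Sx0]; pose T := set_type (A `\` E).
pose t0 : T := SigSub (mem_set Sx0).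
have TA (t : T) : (A `\` E) (val t) by apply: set_mem; exact: valP.
have [|s t Fst|Y [u [v [uv vu du]]]] := @function_metric R T t0 _ (inr 0%N)
  (fun j t => F j (val t)).
- by move=> j t; exact: F_le1.
- by apply: val_inj; apply: F_sep => //; [have [] := TA s|have [] := TA t].
have tE x : A x -> val (insubd t0 (rho x)) = rho x.
  by move=> Ax; rewrite insubdK//; apply: mem_set; exact: rho_in.
have FE j x : A x -> F j (val (insubd t0 (rho x))) = F j x.
  move=> Ax; rewrite tE// /rho; case: ifPn => // /set_mem Ex.
  by rewrite -F_rho.
have rhoid x : (A `\` E) x -> rho x = x by move=> [Ax nEx]; rewrite /rho memNset.
exists Y, (fun x => u (insubd t0 (rho x))), (fun y => val (v y)); split.
- apply/subspace_continuousP => x Ax.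
  apply/(@metricType_numDomainType.cvgrPdist_lt _ Y) => e e0.
  have e2 : 0 < e / 2 by lra.
  apply: filterS (F_equicontinuous x e2) => y Fxy Ay.
  apply: (@le_lt_trans _ _ (e / 2)); last by lra.
  by apply: du => j; rewrite !FE.
- by move=> y; exact: TA.
- by move=> y; rewrite rhoid// valKd vu.
- by move=> x /set_mem Sx; rewrite /= uv tE ?rhoid//; case: Sx.
- move=> x /set_mem Ex; congr (u (insubd _ _)).
  have [Agx nEgx] : (A `\` E) (g x) by apply: gE; exists x.
  by rewrite {1}/rho mem_set// /rho memNset.
Qed.

End gluing.

(** This is the quotient of [A] that identifies each [x] in [E] with [g x]. It is
    realised on the set of representatives [A \ E] by the supremum metric of a
    family of functions that take the same value at [x] and [g x]. *)
Lemma gluing (R : realType) (X : pmetricType R) (A E : set X) (g : X -> X) :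
  compact [set: X] -> closed E -> {within E, continuous g} ->
  g @` E `<=` A `\` E -> (A `\` E) !=set0 ->
  exists (Y : pmetricType R) (q : X -> Y) (s : Y -> X),
    [/\ {within A, continuous q}, (forall y, (A `\` E) (s y)), cancel s q,
      {in A `\` E, cancel q s} & {in E, forall x, q x = q (g x)}].
Proof.
move=> cX clE cg gE nAE; have [z zd] := dense_sequence cX.
exact: (gluing_from_dense cX clE cg gE zd nAE).
Qed.

(** * Invariant measures *)

Section invariant.
Context {R : realType} {Z : ptopologicalType} (phi : R -> Z -> Z).
Context (flow : semiflow phi).
Context (bphi : borel_fun [set p : R * Z | 0 <= p.1] (fun p => phi p.1 p.2)).
Context (mu : probability (borelType Z) R).
Context (mu_inv : forall (t : R) (A : set Z), 0 <= t -> borel A ->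
  mu (phi t @^-1` A) = mu A).

Let mZ (A : set Z) : borel A -> measurable (A : set (borelType Z)).
Proof. by []. Qed.

Lemma borel_flow_time t A : 0 <= t -> borel A -> borel (phi t @^-1` A).
Proof.
move=> t0 bA.
have bt : borel_fun [set: Z] (fun x => (t, x)).
  apply: borel_fun_continuous; first exact: borelT.
  apply: continuous_subspaceT => x U [[A1 A2] /= [nA1 nA2] AU].
  by apply: filterS nA2 => y A2y; apply: AU; split=> //=; exact: nbhs_singleton.
have := bt _ (bphi bA); rewrite setTI; congr borel.
by apply/seteqP; split=> x //= [].
Qed.

(** The preimages of [V] at the multiples of [T] are disjoint and have the measure
    of [V], and the total measure is finite. *)
Lemma wandering_null (V : set Z) T : 0 < T -> borel V ->
  (forall t, T <= t -> phi t @^-1` V `&` V = set0) -> mu V = 0%E.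
Proof.
move=> T0 bV wV; pose F n : set (borelType Z) := phi (n%:R * T) @^-1` V.
have nT n : 0 <= n%:R * T by rewrite mulr_ge0// ltW.
have tF : trivIset setT F.
  apply/trivIsetP => i j _ _; wlog ij : i j / (i < j)%N.
    move=> W ij; have [|ji|ijE] := ltngtP i j; first by move=> /W; exact.
      by rewrite setIC; apply: W => //; rewrite eq_sym.
    by rewrite ijE eqxx in ij.
  move=> _; apply/seteqP; split=> // x [Fi Fj].
  have Tij : T <= (j - i)%:R * T by rewrite ler_peMl ?(ltW T0)// ler1n subn_gt0.
  suff : (phi ((j - i)%:R * T) @^-1` V `&` V) (phi (i%:R * T) x) by rewrite wV.
  split; last exact: Fi.
  by rewrite /= -(proj2 flow)// -mulrDl -natrD subnK// ltnW.
have mF n : measurable (F n : set (borelType Z)).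
  by apply: mZ; exact: borel_flow_time.
have vF : mu V \is a fin_num by apply: fin_num_measure; exact: mZ.
have le1 n : n%:R * fine (mu V) <= 1.
  have mU : measurable (\big[setU/set0]_(i < n) F i).
    by apply: bigsetU_measurable => i _; exact: mF.
  have := @probability_le1 _ _ _ mu _ mU.
  rewrite (@measure_bigsetU_ord _ _ _ mu n xpredT (fun i => F i))//; last first.
    by apply/trivIsetP => i j _ _ ij; move/trivIsetP : tF; apply.
  rewrite (eq_bigr (fun=> (fine (mu V))%:E)) => [|i _]; last first.
    by rewrite fineK//; exact: mu_inv.
  by rewrite sumEFin sumr_const card_ord lee_fin mulr_natl.
have v0 : 0 <= fine (mu V) by rewrite fine_ge0.
rewrite -(fineK vF); congr EFin; apply/eqP; rewrite eq_le v0 andbT leNgt.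
apply/negP => vp; have := le1 (Num.truncn (fine (mu V))^-1).+1.
rewrite leNgt => /negP; apply; rewrite -ltr_pdivrMr// mul1r; exact: truncnS_gt.
Qed.

(** Poincare recurrence: by second countability the wandering points are covered by
    countably many sets of a base that eventually stop returning to themselves. *)
Lemma nonwandering_full : @second_countable Z -> mu (~` nonwandering phi) = 0%E.
Proof.
move=> [B cB [oB bB]]; have [f fB] := countable_enum set0 cB.
pose W : set (set Z) := [set V | B V /\
  exists2 T, 0 < T & forall t, T <= t -> phi t @^-1` V `&` V = set0].
pose F n := if f n \in W then f n else set0.
have bO : borel (nonwandering phi).
  by apply borel_closed; exact: nonwandering_closed.
have cover : ~` nonwandering phi `<=` \bigcup_n F n.
  move=> x /= nOx; have [U nU [T T0 UT]] : exists2 U, nbhs x U & exists2 T, 0 < T &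
      forall t, T <= t -> phi t @^-1` U `&` U = set0.
    apply: contrapT => nU; apply: nOx => U xU T T0; apply: contrapT => nt.
    apply: nU; exists U => //; exists T => // t Tt; apply: contrapT => /eqP/set0P ne.
    by apply: nt; exists t.
  have [V [BV Vx] VU] := bB _ _ nU; have [n fn] := fB _ BV.
  have WV : W V.
    split=> //; exists T => // t Tt; apply/seteqP; split=> // y [Vt Vy].
    by rewrite -(UT t Tt); split; apply: VU.
  by exists n => //; rewrite /F fn mem_set.
have : mu.-negligible (\bigcup_n F n : set (borelType Z)).
  apply: negligible_bigcup => n; rewrite /F; case: ifPn => [/set_mem[Bf [T T0 fT]]|_].
    have bf : borel (f n) by apply borel_open; exact: oB.
    by apply/negligibleP; [exact: mZ|exact: wandering_null T0 bf fT].
  exact: negligible_set0.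
move=> neg; apply/negligibleP; last by apply: negligibleS neg; exact: cover.
by apply: mZ; apply borelC.
Qed.

(** Since [E] can be entered only from the null set [N], invariance forces almost every point
    of [E] to be in [E] again at any given time; but each point of [E] is outside
    [E] at one of the countably many times [1 / (n + 1)]. *)
Lemma transient_null (E N : set Z) : borel E -> borel N -> mu N = 0%E ->
  (forall t, 0 < t -> phi t @^-1` E `<=` E `|` N) ->
  (forall x, E x -> exists n : nat, ~ E (phi n.+1%:R^-1 x)) ->
  mu E = 0%E.
Proof.
move=> bE bN N0 ret leave.
pose F n := E `\` phi n.+1%:R^-1 @^-1` E.
have sub : E `<=` \bigcup_n F n.
  by move=> x Ex; have [n nE] := leave _ Ex; exists n.
have : mu.-negligible (\bigcup_n F n : set (borelType Z)).
  apply: negligible_bigcup => n; set t : R := n.+1%:R^-1.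
  have t0 : 0 < t by rewrite /t invr_gt0 ltr0n.
  have bt : borel (phi t @^-1` E) by apply: borel_flow_time => //; exact: ltW.
  have bF : borel (F n) by apply borelD.
  apply/negligibleP; first exact: mZ.
  have fE : (mu E < +oo)%E by rewrite ltey_eq fin_num_measure//; exact: mZ.
  rewrite /F -/t measureD; [|exact: mZ|exact: mZ|exact: fE].
  suff EE : mu (E `&` phi t @^-1` E) = mu E.
    transitivity (mu E - mu E)%E; first by congr (_ - _)%E.
    by rewrite subee// fin_num_measure//; exact: mZ.
  rewrite -(mu_inv (ltW t0) bE) setIC.
  have bI : borel (phi t @^-1` E `&` E) by apply borelI.
  have null : mu (phi t @^-1` E `\` E) = 0%E.
    apply: (@subset_measure0 _ _ _ mu _ N) => //; first by apply: mZ; apply borelD.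
    by move=> x [/(ret t t0)[]].
  by rewrite (@measureDI _ _ _ mu (phi t @^-1` E) E)//= null add0e.
move=> neg; apply/negligibleP; last by apply: negligibleS neg; exact: sub.
exact: mZ.
Qed.

End invariant.

Section conjugacy.
Context {R : realType} {X Y : ptopologicalType}.
Context (phi : R -> X -> X) (psi : R -> Y -> Y).
Context (S : set X) (j : Y -> X) (q : X -> Y).
Context (bS : borel S) (bj : borel_fun setT j) (bq : borel_fun S q).
Context (jS : forall y, S (j y)) (jq : {in S, cancel q j}) (qj : cancel j q).
Context (bphi : borel_fun [set p : R * X | 0 <= p.1] (fun p => phi p.1 p.2)).
Context (bpsi : borel_fun [set p : R * Y | 0 <= p.1] (fun p => psi p.1 p.2)).
Context (conj : forall t y, 0 <= t -> phi t (j y) = j (psi t y)).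

Let j' : borelType Y -> borelType X := j.
(* Off [S] the value does not matter; a constant keeps the function Borel. *)
Let q' : borelType X -> borelType Y := fun x => if x \in S then q x else point.

Let mj : measurable_fun setT j'.
Proof. by move=> _ B; exact: bj. Qed.

Let mq : measurable_fun setT q'.
Proof.
move=> _ B bB; rewrite setTI.
have -> : q' @^-1` B = (S `&` q @^-1` B) `|` (~` S `&` [set x | B point]).
  apply/seteqP; split=> x /=; rewrite /q'.
    by case: ifPn => [/set_mem|/negP nS]; [left|right; split=> // /mem_set].
  by move=> [[Sx]|[nS]]; [rewrite mem_set|rewrite memNset].
have bB' : borel [set x : X | B point].
  have [Bp|nB] := pselect (B point).
    by rewrite (_ : mkset _ = setT); [exact: borelT|apply/seteqP; split].
  by rewrite (_ : mkset _ = set0); [exact: borel0|apply/seteqP; split].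
by apply: borelU; [exact: bq|apply: borelI => //; exact: borelC].
Qed.

HB.instance Definition _ := @isMeasurableFun.Build _ _ _ _ j' mj.
HB.instance Definition _ := @isMeasurableFun.Build _ _ _ _ q' mq.

(** The push-forwards by [j] and [q] are inverse to each other because nothing is
    lost off [S]. *)
Lemma conjugacy_invariant_measures :
  (forall mu, invariant_measures phi mu -> mu (~` S) = 0%E) ->
  pushforward_bijection j (invariant_measures psi) (invariant_measures phi).
Proof.
move=> full; split.
- move=> mu [_ mu_inv]; exists (distribution mu j'); last by move=> A _.
  split=> // t A t0 bA; rewrite /distribution /pushforward /=.
  rewrite -[RHS](mu_inv t)//; last by have := bj bA; rewrite setTI.
  by congr (mu _); apply/seteqP; split=> y /=; rewrite /j' conj.
- move=> mu1 mu2 _ _ mu12 B bB.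
  have := mu12 _ (bq bB); rewrite /pushforward /=.
  have -> // : j @^-1` (S `&` q @^-1` B) = B.
  by apply/seteqP; split=> y /=; rewrite qj; [case|split].
- move=> nu nuphi; have [_ nu_inv] := nuphi; have nuS := full _ nuphi.
  have aeS (A B : set X) : borel A -> borel B -> A `&` S = B `&` S -> nu A = nu B.
    move=> bA bB AB.
    have split_nu C : borel C -> nu C = nu (C `&` S).
      move=> bC; rewrite (@measureDI _ _ _ nu C S)//=.
      have -> : nu (C `\` S) = 0%E.
        apply: (@subset_measure0 _ _ _ nu _ (~` S)) => //.
        + exact: (borelD bC bS).
        + exact: (borelC bS).
      by rewrite add0e.
    by rewrite (split_nu A)// AB -split_nu.
  have bq' B : borel B -> borel (q' @^-1` B) by move=> bB; have := mq measurableT bB; rewrite setTI.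
  have bj' A : borel A -> borel (j @^-1` A) by move=> bA; have := bj bA; rewrite setTI.
  exists (distribution nu q').
    split=> // t B t0 bB.
    change (nu (q' @^-1` (psi t @^-1` B)) = nu (q' @^-1` B)).
    rewrite -(nu_inv t (q' @^-1` B) t0 (bq' _ bB)).
    have bt : borel (psi t @^-1` B) by exact: borel_flow_time.
    apply: aeS; [exact: bq'|by apply: borel_flow_time => //; exact: bq'|].
    have qphi x : S x -> q' (phi t x) = psi t (q' x).
      move=> Sx; have xE : phi t x = j (psi t (q x)) by rewrite -conj// jq ?inE.
      by rewrite /q' (mem_set Sx) xE mem_set// qj.
    by apply/seteqP; split=> x /= [h Sx]; split=> //; move: h; rewrite qphi.
  move=> A bA; rewrite /pushforward /distribution /=.
  apply: aeS => //; first exact: bq' (bj' _ bA).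
  by apply/seteqP; split=> x /= [h Sx]; split=> //; move: h;
    rewrite /q' (mem_set Sx) jq ?inE.
Qed.

End conjugacy.

(** * Passing to the quotient *)

(** Compactness of [A] reduces the claim to a neighbourhood of each [x] in [A]: if
    [q x = y] this is the hypothesis, and otherwise [q] separates the points near
    [x] from those near [y]. *)
Lemma near_quotient (T X Y W : topologicalType) (A : set X) (q : X -> Y)
    (s : Y -> X) (B : set T) (f : T * Y -> W) (t : T) (y : Y) (U : set W) :
  compact A -> hausdorff_space Y -> {within A, continuous q} ->
  (forall z, A (s z)) -> cancel s q ->
  (forall x, A x -> q x = y ->
    \forall p \near (t, x), B p.1 -> A p.2 -> U (f (p.1, q p.2))) ->
  \forall p \near (t, y), B p.1 -> U (f p).
Proof.
move=> cA hY cq sA sK fU.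
have /compact_near_coveringP cov := cA.
have loc x : A x -> \forall x' \near x & p \near (t, y),
    A x' -> q x' = p.2 -> B p.1 -> U (f p).
  move=> Ax; have [qxy|qxy] := eqVneq (q x) y.
    have [[P Q] /= [nP nQ] PQ] := fU _ Ax qxy.
    exists (Q, P `*` setT) => /=.
      by split=> //; exists (P, setT) => //=; split=> //; exact: filterT.
    move=> [x' [t' y']] /= [Qx' [Pt' _]] Ax' <- Bt'.
    exact: (PQ (t', x')).
  move: hY; rewrite open_hausdorff => /(_ _ _ qxy)[[P Q] /= [Pq Qy] [oP oQ PQ0]].
  have nP : nbhs (q x) P by apply: open_nbhs_nbhs; split=> //; exact: set_mem.
  have nQ : nbhs y Q by apply: open_nbhs_nbhs; split=> //; exact: set_mem.
  have /subspace_continuousP/(_ x Ax _ nP) nqP := cq.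
  exists ([set x' | A x' -> P (q x')], setT `*` Q) => /=.
    by split=> //; exists (setT, Q) => //=; split=> //; exact: filterT.
  move=> [x' [t' y']] /= [Px' [_ Qy']] Ax' qE _.
  have : (P `&` Q) y' by split=> //; rewrite -qE; exact: Px'.
  by rewrite (eqP PQ0).
have := cov _ (nbhs (t, y)) (fun p x' => A x' -> q x' = p.2 -> B p.1 -> U (f p)) _ loc.
by move=> /(_ _)/filterS; apply => -[t' y'] /= /(_ _ (sA y')); apply; rewrite ?sK.
Qed.

(** Exhaustion by the points at distance at least [1 / (n + 1)] from the
    complement. *)
Lemma open_Fsigma (R : realType) (X : metricType R) (U : set X) : open U ->
  exists2 C : nat -> set X, (forall n, closed (C n)) & U = \bigcup_n C n.
Proof.
move=> oU.
exists (fun n => [set x | forall d, ~ U d -> n.+1%:R^-1 <= mdist d x]) => [n|].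
  move=> x clx d Ud; rewrite leNgt; apply/negP => dx.
  have e0 : 0 < n.+1%:R^-1 - mdist d x by rewrite subr_gt0.
  have [y [yC xy]] := clx _ (near_mdist x e0).
  have := yC d Ud; have := metric_triangle d x y; move: xy => /=.
  by rewrite ltrBrDl => h1 h2; rewrite leNgt (le_lt_trans h2 h1).
apply/seteqP; split=> [x Ux|x [n _ xC]]; last first.
  apply: contrapT => nU; have := xC _ nU; rewrite mdistxx leNgt => /negP; apply.
  by rewrite invr_gt0 ltr0n.
have [e /= e0 xeU] : nbhs_ball x U by apply/nbhs_ballP/open_nbhs_nbhs.
have [//|n ne] := @ltr_add_invr R 0 e; rewrite add0r in ne.
exists n => // d nUd; rewrite leNgt; apply/negP => dx; apply/nUd/xeU.
by rewrite ballEmdist /= metric_sym (lt_trans dx).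
Qed.

(** An open subset of the complement of [E] is a countable union of closed sets;
    their traces on [A] are compact, and so are the images of these under [q]. *)
Lemma borel_section (R : realType) (X : metricType R) (Y : topologicalType)
    (A E : set X) (q : X -> Y) (s : Y -> X) :
  compact A -> closed E -> hausdorff_space Y -> {within A, continuous q} ->
  (forall y, (A `\` E) (s y)) -> cancel s q -> {in A `\` E, cancel q s} ->
  borel_fun setT s.
Proof.
move=> cA clE hY cq sS sK qK; apply: borel_fun_open => U oU.
have oUE : open (U `\` E) by rewrite setDE; exact: openI oU (closed_openC clE).
have [C clC UC] := open_Fsigma oUE.
have -> : setT `&` s @^-1` U = \bigcup_n q @` (A `&` C n).
  apply/seteqP; split=> [y [_ Uy]|y [n _ [x [Ax Cx] <-]]].
    have [As nEs] := sS y; have : (U `\` E) (s y) by [].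
    by rewrite UC => -[n _ Cn]; exists n => //; exists (s y).
  have : (U `\` E) x by rewrite UC; exists n.
  by move=> [Ux nEx]; split=> //=; rewrite qK ?inE.
apply: borel_bigcup => n; apply: borel_closed; apply: compact_closed hY _.
apply: continuous_compact; last by apply: compact_closedI.
by apply: continuous_subspaceW cq => x [].
Qed.

Theorem theorem4 (R : realType) (X : pmetricType R)
    (varphi : R -> X -> X) (D : set X) (I : X -> X) :
  let phi := impulsive_semiflow varphi D I in
  let Omega := nonwandering phi in
  compact [set: X] ->
  impulsive_dynamical_system varphi D I ->
  {within Omega, continuous (tauD varphi D)} ->
  I @` (Omega `&` D) `<=` Omega `\` D ->
  exists (Y : pmetricType R) (psi : R -> Y -> Y)
         (h : set_type (Omega `\` D) -> Y) (hinv : Y -> set_type (Omega `\` D)),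
    [/\ compact [set: Y],
        continuous_semiflow psi,
        [/\ continuous h, cancel h hinv, cancel hinv h,
            borel_fun setT h & borel_fun setT hinv],
        (forall (t : R) (x : set_type (Omega `\` D)), 0 <= t ->
          exists2 y : set_type (Omega `\` D),
            set_val y = phi t (set_val x) & psi t (h x) = h y) &
        pushforward_bijection (set_val \o hinv)
          (invariant_measures psi) (invariant_measures phi)].
Proof.
move=> phi Omega cX [flow cD cI tau0 tausup] ctau IOD.
have clD : closed D by apply: compact_closed cD; exact: metric_hausdorff.
have phiflow : semiflow phi by exact: impulsive_semiflowP.
have clO : closed Omega by exact: nonwandering_closed.
have cO : compact Omega by exact: subclosed_compact clO cX _.
have inv t x : 0 <= t -> (Omega `\` D) x -> (Omega `\` D) (phi t x).
  exact: (nonwandering_invariant flow clD tau0 tausup IOD).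
have [x0 Sx0] : (Omega `\` D) !=set0.
  have [x Ox] : Omega !=set0 by exact: nonwandering_nonempty.
  have [Dx|nDx] := pselect (D x); last by exists x.
  by exists (I x); apply: IOD; exists x.
have OE : Omega `\` (Omega `&` D) = Omega `\` D by rewrite setDIr setDv set0U.
have [||||Y [q [s [cq sS sK qK qI]]]] := @gluing R X Omega (Omega `&` D) I cX.
- exact: closedI.
- by apply: continuous_subspaceW cI => x [].
- by rewrite OE.
- by exists x0; rewrite OE.
rewrite OE in sS qK.
have hY : hausdorff_space Y by exact: metric_hausdorff.
have cY : compact [set: Y].
  rewrite (_ : setT = q @` Omega); first exact: continuous_compact.
  by apply/seteqP; split=> // y _; exists (s y) => //; case: (sS y).
pose psi t y := q (phi t (s y)).
have spsi t y : 0 <= t -> s (psi t y) = phi t (s y).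
  by move=> t0; rewrite qK// inE; exact: inv.
have rhoE z : Omega z -> s (q z) = if z \in D then I z else z.
  move=> Oz; case: ifPn => [/set_mem Dz|/negP nDz].
    by rewrite qI ?inE// qK// inE; apply: IOD; exists z.
  by rewrite qK// inE; split=> // /mem_set.
have psi_near t y (U : set Y) : 0 <= t -> nbhs (psi t y) U ->
    \forall p \near (t, y), 0 <= p.1 -> U (psi p.1 p.2).
  move=> t0 nU.
  apply: (@near_quotient R X Y Y Omega q s [set t | 0 <= t] (fun p => psi p.1 p.2)) => //.
    by move=> z; case: (sS z).
  move=> x Ox qxy; have := glued_flow_near flow clD tau0 tausup IOD ctau cI cq qI t0 Ox.
  rewrite -rhoE// qxy => /(_ U nU); apply: filterS => -[t' x'] /= UP t'0 Ox'.
  by rewrite /psi rhoE//; exact: UP.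
have psiflow : continuous_semiflow psi.
  split.
    split=> [y|t' t y t'0 t0]; first by rewrite /psi (proj1 phiflow).
    by rewrite {2}/psi spsi// /psi (proj2 phiflow).
  by apply/subspace_continuousP => -[t y] /= t0 U nU; exact: psi_near.
pose hinv y : set_type (Omega `\` D) := SigSub (mem_set (sS y)).
pose h (x : set_type (Omega `\` D)) : Y := q (set_val x).
have vS (x : set_type (Omega `\` D)) : (Omega `\` D) (set_val x).
  by apply: set_mem; exact: valP.
have hcont : continuous h.
  have : {within Omega `\` D, continuous q} by apply: continuous_subspaceW cq => x [].
  by move/subspace_sigL_continuousP.
have bs : borel_fun setT s.
  exact: (borel_section cO clD hY cq sS sK qK).
exists Y, psi, h, hinv; split=> //.
- split=> //.
  + by move=> x; apply: val_inj; rewrite /= /h qK// inE; exact: vS.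
  + apply: borel_fun_continuous; first exact: borelT.
    exact: continuous_subspaceT.
  + apply: borel_fun_open => U [V oV <-].
    have := bs V (borel_open oV); congr borel.
- move=> t x t0; exists (SigSub (mem_set (inv t _ t0 (vS x)))) => //.
  by rewrite /psi /h qK// inE; exact: vS.
- have scX := compact_second_countable cX.
  have bphi : borel_fun [set p : R * X | 0 <= p.1] (fun p => phi p.1 p.2).
    exact: (borel_impulsive_semiflow flow clD tau0 tausup cI scX).
  have bS : borel (Omega `\` D) by apply: borelD; apply: borel_closed.
  apply: (@conjugacy_invariant_measures R X Y phi psi (Omega `\` D) s q) => //.
  + apply: borel_fun_continuous => //.
    by apply: continuous_subspaceW cq => x [].
  + exact: borel_fun_continuous (borel_closed (@closed_nonneg_time R Y)) (proj2 psiflow).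
  + by move=> t y t0; rewrite spsi.
  + move=> mu [_ mu_inv]; have nO := nonwandering_full phiflow bphi mu_inv scX.
    have nE : mu (Omega `&` D) = 0%E.
      apply: (transient_null bphi mu_inv _ _ nO).
      * by apply borelI; apply borel_closed.
      * by apply borelC; apply borel_closed.
      * move=> t t0 x [Otx Dtx]; have [Ox|] := pselect (Omega x); last by right.
        have [Dx|nDx] := pselect (D x); [by left|].
        by have [] := inv t x (ltW t0) (conj Ox nDx).
      (* an orbit that starts in D is off D until its first passage time *)
      * move=> x [Ox Dx]; have [r r0 rx] : exists2 r : R, 0 < r & (r%:E <= tau1 varphi D x)%E.
          have [->|[r -> r0]] := tau1_cases tau0 x; last by exists r.
          by exists 1 => //; rewrite leey.
        have [//|n nr] := @ltr_add_invr R 0 r; rewrite add0r in nr.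
        exists n => -[_]; have nx : (n.+1%:R^-1%:E < tau1 varphi D x)%E.
          by apply: lt_le_trans rx; rewrite lte_fin.
        have n0 : (0 : R) < n.+1%:R^-1 by rewrite invr_gt0 ltr0n.
        by rewrite /phi impulsive_before_hit//; exact: (tau1_nohit n0 nx).
    have -> : ~` (Omega `\` D) = ~` Omega `|` (Omega `&` D).
      rewrite setDE setCI setCK; apply/seteqP; split=> x [nO'|Dx]; [by left| |by left|].
        by have [Ox|] := pselect (Omega x); [right|left].
      by right; case: Dx.
    rewrite measureU0//.
    * by apply: borelC; exact: borel_closed.
    * by apply: borelI; exact: borel_closed.
Qed.
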